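(* The bounded theory of $\mathbb R_C$ is at least as difficult as arithmetic: $\mathbf 0^{(\omega)}\le_m\mathrm{Th}_B(\mathbb R_C)$.
   Context: A name of $x\in\mathbb R$ is a sequence $(q_i)_i$ of rationals with $|q_i-x|<2^{-i}$ for all $i$; similarly for $\mathbb R^n$ with the Euclidean norm. A function $f:\mathbb R\to\mathbb R$ is (Type-Two) computable if there is an oracle Turing machine $M$ such that for all $x\in\mathbb R$ and every name $p$ of $x$, the sequence $(M^p(i))_i$ is a name of $f(x)$. $\mathbb R_C$ is the ordered field $\mathbb R$ expanded by all (total) univariate Type-Two computable functions $\mathbb R\to\mathbb R$, and $\mathcal L_C$ is its language (rational constants, $+,\cdot,\ge,>$ and a unary symbol for each such function, the symbols being coded by indices of oracle machines computing them), so sentences are coded by natural numbers. A bounded formula is $Q_1^{[a_1,b_1]}y_1\cdots Q_n^{[a_n,b_n]}y_n\,\psi$ with $Q_i\in\{\exists,\forall\}$, $\psi$ quantifier-free (in conjunctive normal form), and $[a_i,b_i]$ closed intervals whose endpoints are terms that may depend on the free variables and on $y_1,\dots,y_{i-1}$; here $\exists^{[a,b]}y\,\chi:=\exists y(a\le y\wedge y\le b\wedge\chi)$ and $\forall^{[a,b]}y\,\chi:=\forall y(a\le y\wedge y\le b\to\chi)$. $\mathrm{Th}_B(\mathbb R_C)$ is the set of (codes of) bounded $\mathcal L_C$-sentences true in $\mathbb R_C$. $\mathbf 0^{(k)}$ is the $k$-th iterated Turing jump and $\mathbf 0^{(\omega)}=\{\langle n,k\rangle : n\in\mathbf 0^{(k)}\}$,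 with $\langle\cdot,\cdot\rangle$ a standard computable pairing. For $A,B\subseteq\mathbb N$, $A\le_mB$ means there is a computable $g:\mathbb N\to\mathbb N$ with $n\in A\iff g(n)\in B$ for all $n$. *)

(* Defs.v *)
From Stdlib Require Import Reals QArith Qreals ZArith List Arith Cantor.
From Stdlib Require Import ClassicalEpsilon.
Import ListNotations.
Local Open Scope nat_scope.

(** * Codes *)

Definition pairn (m n : nat) : nat := Cantor.to_nat (m, n).

Fixpoint code_list (l : list nat) : nat :=
  match l with
  | [] => 0
  | x :: l' => S (pairn x (code_list l'))
  end.

Definition code_Z (z : Z) : nat := pairn (Z.to_nat z) (Z.to_nat (- z)).

(** Rationals are coded through arbitrary, not necessarily reduced, fractions. *)
Definition code_Q (q : Q) : nat := pairn (code_Z (Qnum q)) (Pos.to_nat (Qden q)).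

(** * Oracle Turing machines *)

(** A two-way infinite tape: the cells to the left of the head, nearest first,
    and the cells from the scanned one rightwards. All cells not listed are
    blank. The symbol 0 is the blank and 1 is the stroke used for unary
    numbers. *)
Record tape := Tape { tleft : list nat; tright : list nat }.

Inductive move := MoveL | MoveR | Stay.

Definition code_move (d : move) : nat :=
  match d with MoveL => 0 | MoveR => 1 | Stay => 2 end.

Definition scanned (t : tape) : nat := hd 0 (tright t).

Definition write (s : nat) (t : tape) : tape := Tape (tleft t) (s :: tl (tright t)).

Definition shift (d : move) (t : tape) : tape :=
  match d with
  | MoveL => Tape (tl (tleft t)) (hd 0 (tleft t) :: tright t)
  | MoveR => Tape (scanned t :: tleft t) (tl (tright t))
  | Stay => t
  end.

Definition unary (n : nat) : tape := Tape [] (repeat 1 n).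

Definition strokes (t : tape) : nat :=
  count_occ Nat.eq_dec (tleft t) 1 + count_occ Nat.eq_dec (tright t) 1.

(** In state [source], if the scanned symbols of the tapes are the [sym_read]s
    of [actions] (one action for each tape), perform the actions and go to
    state [target]. *)
Record action := Action { sym_read : nat; sym_written : nat; head_move : move }.

Record instruction :=
  Instruction { source : nat; actions : list action; target : nat }.

(** Multi-tape machines. Tape 0 is used for input and output, tape 1 is the
    query tape, and there are [work_tapes] further tapes. If several
    instructions are applicable, the first one in the program is executed. *)
Record machine := Machine { work_tapes : nat; program : list instruction }.

Definition start_state : nat := 0.
Definition query_state : nat := 1.
Definition answer_state : nat := 2.

Definition code_action (a : action) : nat :=
  pairn (sym_read a) (pairn (sym_written a) (code_move (head_move a))).

Definition code_instruction (i : instruction) : nat :=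
  pairn (source i) (pairn (code_list (map code_action (actions i))) (target i)).

(** The index of a machine. *)
Definition code_machine (M : machine) : nat :=
  pairn (work_tapes M) (code_list (map code_instruction (program M))).

Record config := Config { state : nat; tapes : list tape }.

Definition applicable (c : config) (i : instruction) : bool :=
  if Nat.eq_dec (source i) (state c) then
    if list_eq_dec Nat.eq_dec (map sym_read (actions i)) (map scanned (tapes c))
    then true else false
  else false.

Definition act (a : action) (t : tape) : tape :=
  shift (head_move a) (write (sym_written a) t).

(** The oracle replaces the number [n] on the query tape by [O n], putting the
    head on the first cell of the answer. *)
Definition query (O : nat -> nat) (ts : list tape) : list tape :=
  match ts with
  | io :: q :: ws => io :: unary (O (strokes q)) :: ws
  | _ => ts
  end.

(** [None] means that the machine has halted. *)
Definition step (O : nat -> nat) (M : machine) (c : config) : option config :=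
  if Nat.eq_dec (state c) query_state then
    Some (Config answer_state (query O (tapes c)))
  else
    match find (applicable c) (program M) with
    | Some i =>
        Some (Config (target i)
          (map (fun at_ => act (fst at_) (snd at_)) (combine (actions i) (tapes c))))
    | None => None
    end.

Definition init (M : machine) (n : nat) : config :=
  Config start_state (unary n :: unary 0 :: repeat (unary 0) (work_tapes M)).

Fixpoint run (O : nat -> nat) (M : machine) (k : nat) (c : config) : config :=
  match k with
  | 0 => c
  | S k' => match step O M c with Some c' => run O M k' c' | None => c end
  end.

Definition output (c : config) : nat := strokes (hd (unary 0) (tapes c)).

(** M^O(n) is defined and equal to m; the output is the number of strokes left
    on tape 0. *)
Definition computes (M : machine) (O : nat -> nat) (n m : nat) : Prop :=
  exists k : nat,
    step O M (run O M k (init M n)) = None /\ output (run O M k (init M n)) = m.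

(** * Turing jumps and many-one reducibility *)

Definition char_fun (A : nat -> Prop) (n : nat) : nat :=
  if excluded_middle_informative (A n) then 1 else 0.

Definition computable (g : nat -> nat) : Prop :=
  exists M : machine, forall n : nat, computes M (fun _ => 0) n (g n).

Definition many_one_reducible (A B : nat -> Prop) : Prop :=
  exists g : nat -> nat, computable g /\ forall n : nat, A n <-> B (g n).

Definition jump (A : nat -> Prop) (e : nat) : Prop :=
  exists M : machine,
    code_machine M = e /\ exists m : nat, computes M (char_fun A) e m.

Definition zero_jump (k : nat) : nat -> Prop := Nat.iter k jump (fun _ => False).

Definition zero_omega (m : nat) : Prop :=
  exists n k : nat, m = pairn n k /\ zero_jump k n.

(** * Type-Two computable real functions *)

Definition is_name (q : nat -> Q) (x : R) : Prop :=
  forall i : nat, (Rabs (Q2R (q i) - x) < / 2 ^ i)%R.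

Definition realizes (M : machine) (f : R -> R) : Prop :=
  forall (x : R) (p : nat -> Q), is_name p x ->
    exists r : nat -> Q,
      is_name r (f x) /\
      forall i : nat, computes M (fun j => code_Q (p j)) i (code_Q (r i)).

(** * The structure R_C and its bounded theory *)

(** A function symbol is a machine computing some total function; this function
    is unique because every real has a name and machines are deterministic. *)
Definition symbol : Type := { M : machine | exists f : R -> R, realizes M f }.

Definition interp (s : symbol) : R -> R :=
  proj1_sig (constructive_indefinite_description _ (proj2_sig s)).

(** Variables are de Bruijn indices. *)
Inductive term :=
| Var (i : nat)
| Const (q : Q)
| Add (s t : term)
| Mul (s t : term)
| App (h : symbol) (t : term).

Inductive atom :=
| Ge (s t : term)
| Gt (s t : term).

Inductive literal :=
| Positive (a : atom)
| Negated (a : atom).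

(** A conjunction of disjunctions of literals. *)
Definition cnf : Type := list (list literal).

Inductive quantifier := Ex | All.

(** [Quant q a b phi] binds variable 0 of [phi] to range over [a, b]; the
    endpoints [a] and [b] are outside the scope of the quantifier. *)
Inductive bformula :=
| Matrix (psi : cnf)
| Quant (q : quantifier) (a b : term) (phi : bformula).

Definition extend (y : R) (rho : nat -> R) (i : nat) : R :=
  match i with 0 => y | S j => rho j end.

Fixpoint eval (rho : nat -> R) (t : term) : R :=
  match t with
  | Var i => rho i
  | Const q => Q2R q
  | Add s t => (eval rho s + eval rho t)%R
  | Mul s t => (eval rho s * eval rho t)%R
  | App h t => interp h (eval rho t)
  end.

Definition sat_atom (rho : nat -> R) (a : atom) : Prop :=
  match a with
  | Ge s t => (eval rho s >= eval rho t)%R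
  | Gt s t => (eval rho s > eval rho t)%R
  end.

Definition sat_literal (rho : nat -> R) (l : literal) : Prop :=
  match l with
  | Positive a => sat_atom rho a
  | Negated a => ~ sat_atom rho a
  end.

Definition sat_cnf (rho : nat -> R) (psi : cnf) : Prop :=
  Forall (Exists (sat_literal rho)) psi.

Fixpoint sat (rho : nat -> R) (phi : bformula) : Prop :=
  match phi with
  | Matrix psi => sat_cnf rho psi
  | Quant Ex a b phi =>
      exists y : R,
        (eval rho a <= y)%R /\ (y <= eval rho b)%R /\ sat (extend y rho) phi
  | Quant All a b phi =>
      forall y : R,
        (eval rho a <= y)%R /\ (y <= eval rho b)%R -> sat (extend y rho) phi
  end.

(** All free variables are below [n]. *)
Fixpoint term_below (n : nat) (t : term) : Prop :=
  match t with
  | Var i => i < n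
  | Const _ => True
  | Add s t | Mul s t => term_below n s /\ term_below n t
  | App _ t => term_below n t
  end.

Definition atom_below (n : nat) (a : atom) : Prop :=
  match a with Ge s t | Gt s t => term_below n s /\ term_below n t end.

Definition literal_below (n : nat) (l : literal) : Prop :=
  match l with Positive a | Negated a => atom_below n a end.

Fixpoint bformula_below (n : nat) (phi : bformula) : Prop :=
  match phi with
  | Matrix psi => Forall (Forall (literal_below n)) psi
  | Quant _ a b phi =>
      term_below n a /\ term_below n b /\ bformula_below (S n) phi
  end.

Definition is_sentence (phi : bformula) : Prop := bformula_below 0 phi.

Fixpoint code_term (t : term) : nat :=
  match t with
  | Var i => pairn 0 i
  | Const q => pairn 1 (code_Q q)
  | Add s t => pairn 2 (pairn (code_term s) (code_term t))
  | Mul s t => pairn 3 (pairn (code_term s) (code_term t))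
  | App h t => pairn 4 (pairn (code_machine (proj1_sig h)) (code_term t))
  end.

Definition code_atom (a : atom) : nat :=
  match a with
  | Ge s t => pairn 0 (pairn (code_term s) (code_term t))
  | Gt s t => pairn 1 (pairn (code_term s) (code_term t))
  end.

Definition code_literal (l : literal) : nat :=
  match l with
  | Positive a => pairn 0 (code_atom a)
  | Negated a => pairn 1 (code_atom a)
  end.

Definition code_cnf (psi : cnf) : nat :=
  code_list (map (fun c => code_list (map code_literal c)) psi).

Definition code_quantifier (q : quantifier) : nat :=
  match q with Ex => 1 | All => 2 end.

Fixpoint code_bformula (phi : bformula) : nat :=
  match phi with
  | Matrix psi => pairn 0 (code_cnf psi)
  | Quant q a b phi =>
      pairn (code_quantifier q)
        (pairn (code_term a) (pairn (code_term b) (code_bformula phi)))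
  end.

(** The valuation is irrelevant for sentences. *)
Definition Th_B (n : nat) : Prop :=
  exists phi : bformula,
    code_bformula phi = n /\ is_sentence phi /\ sat (fun _ => 0%R) phi.

(* Main.v *)
From Stdlib Require Import Reals QArith Qreals ZArith List Arith Cantor Lia Lra.
From Stdlib Require Import Classical ClassicalEpsilon FunctionalExtensionality PropExtensionality.
Require Import Defs.
Import ListNotations.
Local Open Scope nat_scope.

(** The bounded quantifiers over [[0, 1]] interpret second-order arithmetic. A number [n]
    is coded by [1 / (n + 1)]; this turns the pairing function into a polynomial relation.
    The set of these codes, and the membership of [n] in the set coded by a real in base 4,
    are defined by two functions that measure the distance to a grid of mesh
    [1 / (N (N + 1) B^N)] on [[1 / (N + 1), 1 / N]], for [B = 1] and [B = 4]. These functions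
    are 1-Lipschitz and map rationals to rationals in a primitive recursive way, so an
    oracle machine computes them by a single query: applied entrywise, they turn names
    into names. As [0^(omega)] is the only set that satisfies the arithmetical recursion
    for the jump hierarchy, "[m] is in [0^(omega)]" is one formula of second-order
    arithmetic, and the reduction only inserts the constant [1 / (m + 1)] into it. *)

(** * Register programs on Turing machines *)

(** Computable real functions are continuous, so none of them is the characteristic function of the
    codes or of membership in a coded set. The discontinuity has to come from comparing values: a
    distance function is computable, and [>=] separates its zeros, or its large values, from the
    rest. Numbers become fractions because the quantifiers range over a fixed bounded interval, into
    which the integers do not fit; the price is a mesh that gets finer from cell to cell, with
    functions glued at the cell ends. Reals acting as sets also settle recursion: searches in lists
    and runs of machines are described as membership in every set closed under the rules, so no
    finite sequences of configurations have to be coded. Since one quantifier prefix serves all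
    levels of the hierarchy, computing the reduction amounts to pairing numerals, and primitive
    recursive programs suffice for all machines to be built. A small while language lies in between
    and confines the handling of tapes to two instructions and a loop. *)

Inductive com :=
| Inc (r : nat)
| Dec (r : nat)
| Seq (c1 c2 : com)
| While (r : nat) (c : com).

Definition upd (s : nat -> nat) (r v : nat) : nat -> nat :=
  fun x => if x =? r then v else s x.

Lemma upd_eq s r v : upd s r v r = v.
Proof. unfold upd. now rewrite Nat.eqb_refl. Qed.

Lemma upd_neq s r v x : x <> r -> upd s r v x = s x.
Proof. intros H. unfold upd. now rewrite (proj2 (Nat.eqb_neq x r) H). Qed.

Inductive exec : com -> (nat -> nat) -> (nat -> nat) -> Prop :=
| exec_inc r s : exec (Inc r) s (upd s r (S (s r)))
| exec_dec r s : exec (Dec r) s (upd s r (pred (s r)))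
| exec_seq c1 c2 s s1 s2 : exec c1 s s1 -> exec c2 s1 s2 -> exec (Seq c1 c2) s s2
| exec_done r c s : s r = 0 -> exec (While r c) s s
| exec_loop r c s s1 s2 :
    s r <> 0 -> exec c s s1 -> exec (While r c) s1 s2 -> exec (While r c) s s2.

Fixpoint regs_below (n : nat) (c : com) : Prop :=
  match c with
  | Inc r | Dec r => r < n
  | Seq c1 c2 => regs_below n c1 /\ regs_below n c2
  | While r c => r < n /\ regs_below n c
  end.

Lemma regs_below_mono n m c : n <= m -> regs_below n c -> regs_below m c.
Proof. intros H; induction c; simpl; intuition lia. Qed.

Lemma regs_below_ex c : exists n, regs_below n c.
Proof.
  induction c as [r|r|c1 [n1 H1] c2 [n2 H2]|r c [n H]]; simpl.
  - exists (S r); lia.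
  - exists (S r); lia.
  - exists (max n1 n2); split; [apply (regs_below_mono n1)|apply (regs_below_mono n2)]; auto; lia.
  - exists (max (S r) n); split; [lia|]. apply (regs_below_mono n); auto; lia.
Qed.

(** [Node r (w1, d1) q1 (w0, d0) q0] inspects tape [r] only: on a stroke it writes
    [w1], moves by [d1] and goes to state [q1]; otherwise likewise with [w0], [d0], [q0]. *)
Inductive node := Node (r : nat) (a1 : nat * move) (q1 : nat) (a0 : nat * move) (q0 : nat).

Definition goto (q : nat) : node := Node 0 (1, Stay) q (0, Stay) q.

(** [s] is the address of the first node, and control leaves at [s + length (comp c s)]. A number is
    a block of strokes starting at the head, so it changes at its left end. [Inc] takes two nodes
    because an action writes before it moves: step left, then write a stroke. [Dec] erases the first
    stroke and steps right, or stays on a blank. *)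
Fixpoint comp (c : com) (s : nat) : list node :=
  match c with
  | Inc r => [Node r (1, MoveL) (s + 1) (0, MoveL) (s + 1);
              Node r (1, Stay) (s + 2) (1, Stay) (s + 2)]
  | Dec r => [Node r (0, MoveR) (s + 1) (0, Stay) (s + 1)]
  | Seq c1 c2 => comp c1 s ++ comp c2 (s + length (comp c1 s))
  | While r c =>
      Node r (1, Stay) (s + 1) (0, Stay) (s + length (comp c (s + 1)) + 2)
        :: comp c (s + 1) ++ [goto s]
  end.

Definition node_action (nd : node) (j x : nat) : action :=
  let '(Node r a1 _ a0 _) := nd in
  if j =? r then if x =? 1 then Action x (fst a1) (snd a1) else Action x (fst a0) (snd a0)
  else Action x x Stay.

Fixpoint node_actions (nd : node) (j : nat) (w : list nat) : list action :=
  match w with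
  | [] => []
  | x :: w' => node_action nd j x :: node_actions nd (S j) w'
  end.

Definition node_target (nd : node) (w : list nat) : nat :=
  let '(Node r _ q1 _ q0) := nd in if nth r w 0 =? 1 then q1 else q0.

Definition node_instruction (q : nat) (nd : node) (w : list nat) : instruction :=
  Instruction q (node_actions nd 0 w) (node_target nd w).

Fixpoint words (n : nat) : list (list nat) :=
  match n with
  | 0 => [[]]
  | S n' => map (cons 0) (words n') ++ map (cons 1) (words n')
  end.

(** An instruction names the scanned symbol of every tape, so a node that looks at one tape becomes
    [2 ^ T] instructions, one for each word of blanks and strokes. The input tape and the query tape
    are not counted as work tapes, hence [T - 2]. *)
Definition node_machine (T : nat) (l : list node) : machine :=
  Machine (T - 2)
    (flat_map (fun qn => map (node_instruction (fst qn) (snd qn)) (words T))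
       (combine (seq 0 (length l)) l)).

Lemma words_in w : Forall (fun x => x = 0 \/ x = 1) w -> In w (words (length w)).
Proof.
  induction 1 as [|x w Hx _ IH]; simpl; [auto|].
  apply in_or_app. destruct Hx as [-> | ->]; [left|right]; now apply in_map.
Qed.

Lemma node_actions_read nd j w : map sym_read (node_actions nd j w) = w.
Proof.
  revert j; induction w as [|x w IH]; intros j; simpl; [reflexivity|].
  rewrite IH. f_equal. destruct nd as [r a1 q1 a0 q0]; simpl.
  destruct (j =? r), (x =? 1); reflexivity.
Qed.

Lemma find_unique {A} (p : A -> bool) (l : list A) x :
  In x l -> p x = true -> (forall y, In y l -> p y = true -> y = x) -> find p l = Some x.
Proof.
  intros Hin Hp Hu. destruct (find p l) as [y|] eqn:E.
  - apply find_some in E as [Hy Hpy]. now rewrite (Hu y Hy Hpy).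
  - pose proof (find_none _ _ E x Hin) as H. congruence.
Qed.

Lemma in_indexed {A} (l : list A) k q x :
  In (q, x) (combine (seq k (length l)) l) <-> k <= q /\ nth_error l (q - k) = Some x.
Proof.
  revert k; induction l as [|y l IH]; intros k; simpl.
  - split; [tauto|]. intros [_ H]. now destruct (q - k).
  - rewrite IH. split.
    + intros [E | [H1 H2]].
      * injection E as -> ->. now rewrite Nat.sub_diag.
      * split; [lia|]. now replace (q - k) with (S (q - S k)) by lia.
    + intros [H1 H2]. destruct (Nat.eq_dec k q) as [->|Hne].
      * rewrite Nat.sub_diag in H2. injection H2 as ->. auto.
      * right. split; [lia|]. now replace (q - k) with (S (q - S k)) in H2 by lia.
Qed.

Lemma applicable_iff c i :
  applicable c i = true <->
  source i = state c /\ map sym_read (actions i) = map scanned (tapes c).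
Proof.
  unfold applicable. destruct (Nat.eq_dec _ _); [destruct (list_eq_dec _ _ _)|];
    split; try tauto; try discriminate.
Qed.

Definition node_tapes (nd : node) (ts : list tape) : list tape :=
  map (fun at_ => act (fst at_) (snd at_)) (combine (node_actions nd 0 (map scanned ts)) ts).

Lemma node_machine_in T l i :
  In i (program (node_machine T l)) <->
  exists q nd w, nth_error l q = Some nd /\ In w (words T) /\ i = node_instruction q nd w.
Proof.
  unfold node_machine; simpl. rewrite in_flat_map. split.
  - intros [[q nd] [H1 H2]]. apply in_indexed in H1 as [_ H1]. rewrite Nat.sub_0_r in H1.
    apply in_map_iff in H2 as [w [<- Hw]]. eauto 6.
  - intros (q & nd & w & H1 & H2 & ->). exists (q, nd). split.
    + apply in_indexed. rewrite Nat.sub_0_r. split; [lia|assumption].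
    + simpl. now apply in_map.
Qed.

(** The source state and the word read determine the instruction, so the first applicable one is the
    only one. In state 1 the machine would query the oracle instead. *)
Lemma node_step O T l q nd ts :
  q <> 1 -> nth_error l q = Some nd -> length ts = T ->
  Forall (fun t => scanned t = 0 \/ scanned t = 1) ts ->
  step O (node_machine T l) (Config q ts)
    = Some (Config (node_target nd (map scanned ts)) (node_tapes nd ts)).
Proof.
  intros Hq Hnd HT Hts. unfold step. simpl state.
  destruct (Nat.eq_dec q query_state) as [|_]; [contradiction|].
  rewrite (find_unique _ _ (node_instruction q nd (map scanned ts))).
  - reflexivity.
  - apply node_machine_in. exists q, nd, (map scanned ts). repeat split; auto.
    rewrite <- HT, <- (length_map scanned ts). apply words_in.
    apply Forall_map. exact Hts.
  - apply applicable_iff. simpl. now rewrite node_actions_read.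
  - intros i Hi Ha. apply node_machine_in in Hi as (q' & nd' & w & H1 & H2 & ->).
    apply applicable_iff in Ha as [E1 E2]. simpl in E1, E2. subst q'.
    rewrite node_actions_read in E2. congruence.
Qed.

Lemma node_halt O T l ts :
  length l <> 1 ->
  step O (node_machine T l) (Config (length l) ts) = None.
Proof.
  intros Hq. unfold step. simpl state.
  destruct (Nat.eq_dec _ query_state) as [|_]; [contradiction|].
  destruct (find _ _) as [i|] eqn:E; [|reflexivity]. exfalso.
  apply find_some in E as [Hi Ha].
  apply node_machine_in in Hi as (q' & nd' & w & H1 & H2 & ->).
  apply applicable_iff in Ha as [E1 E2]. simpl in E1. subst q'.
  assert (length l < length l); [|lia]. apply nth_error_Some. congruence.
Qed.

(** Head movements leave listed blanks on both sides, so a register is a tape only up to padding.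
    Having nothing but blanks on the left is what allows [Inc] to extend the block there. *)
Definition represents (t : tape) (n : nat) : Prop :=
  exists a b, t = Tape (repeat 0 a) (repeat 1 n ++ repeat 0 b).

Definition tapes_represent (T : nat) (s : nat -> nat) (ts : list tape) : Prop :=
  length ts = T /\ forall r, r < T -> represents (nth r ts (unary 0)) (s r).

Lemma represents_unary n : represents (unary n) n.
Proof. exists 0, 0. unfold unary. simpl. now rewrite app_nil_r. Qed.

Lemma represents_scanned t n : represents t n -> scanned t = if n =? 0 then 0 else 1.
Proof. intros (a & b & ->). destruct n; [destruct b|]; reflexivity. Qed.

Lemma represents_strokes t n : represents t n -> strokes t = n.
Proof.
  intros (a & b & ->). unfold strokes; simpl. rewrite count_occ_app.
  rewrite (count_occ_repeat_eq _ (x := 1) (y := 1)) by reflexivity.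
  rewrite !(count_occ_repeat_neq _ (x := 1) (y := 0)) by discriminate. lia.
Qed.

Lemma represents_rewrite t n : represents t n -> represents (act (Action (scanned t) (scanned t) Stay) t) n.
Proof.
  intros (a & b & ->). destruct n; [destruct b|].
  - exists a, 1. reflexivity.
  - exists a, (S b). reflexivity.
  - exists a, b. reflexivity.
Qed.

Lemma tapes_represent_scanned T s ts :
  tapes_represent T s ts -> Forall (fun t => scanned t = 0 \/ scanned t = 1) ts.
Proof.
  intros [HT H]. apply Forall_forall. intros t Ht.
  apply (In_nth _ _ (unary 0)) in Ht as (r & Hr & <-).
  rewrite (represents_scanned _ _ (H r ltac:(lia))). destruct (s r =? 0); auto.
Qed.

Lemma nth_actions nd j ts k :
  k < length ts ->
  nth k (map (fun at_ => act (fst at_) (snd at_))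
           (combine (node_actions nd j (map scanned ts)) ts)) (unary 0)
  = act (node_action nd (j + k) (scanned (nth k ts (unary 0)))) (nth k ts (unary 0)).
Proof.
  revert j k; induction ts as [|t ts IH]; intros j k Hk; simpl in *; [lia|].
  destruct k as [|k].
  - now rewrite Nat.add_0_r.
  - rewrite IH by lia. now replace (S j + k) with (j + S k) by lia.
Qed.

Lemma length_node_tapes nd ts : length (node_tapes nd ts) = length ts.
Proof.
  unfold node_tapes. rewrite length_map.
  enough (H : forall j, length (combine (node_actions nd j (map scanned ts)) ts) = length ts)
    by apply H.
  induction ts as [|t ts IH]; intros j; simpl; auto.
Qed.

(** * Runs of compiled programs *)

Definition reach (O : nat -> nat) (M : machine) (c c' : config) : Prop :=
  exists k, run O M k c = c'.

Lemma run_add O M k k' c : run O M (k + k') c = run O M k' (run O M k c).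
Proof.
  revert c; induction k as [|k IH]; intros c; simpl; [reflexivity|].
  destruct (step O M c) eqn:E; [apply IH|]. destruct k'; simpl; [reflexivity|now rewrite E].
Qed.

Lemma reach_trans O M c1 c2 c3 : reach O M c1 c2 -> reach O M c2 c3 -> reach O M c1 c3.
Proof. intros [k <-] [k' <-]. exists (k + k'). apply run_add. Qed.

Lemma reach_step O M c c' : step O M c = Some c' -> reach O M c c'.
Proof. intros H. exists 1. simpl. now rewrite H. Qed.

Lemma node_reach O T l s ts q r a1 q1 a0 q0 v :
  q <> 1 -> nth_error l q = Some (Node r a1 q1 a0 q0) -> r < T ->
  tapes_represent T s ts ->
  (forall t, represents t (s r) ->
     let a := if s r =? 0 then a0 else a1 in
     represents (act (Action (scanned t) (fst a) (snd a)) t) v) ->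
  exists ts', tapes_represent T (upd s r v) ts' /\
    reach O (node_machine T l) (Config q ts) (Config (if s r =? 0 then q0 else q1) ts').
Proof.
  intros Hq Hnd Hr Hts Hv. pose proof (tapes_represent_scanned _ _ _ Hts) as Hsc.
  destruct Hts as [HT Hrep].
  exists (node_tapes (Node r a1 q1 a0 q0) ts). split.
  - split; [now rewrite length_node_tapes|]. intros k Hk. unfold node_tapes.
    rewrite nth_actions by lia. simpl.
    specialize (Hrep k Hk). unfold upd. destruct (Nat.eqb_spec k r) as [->|Hne].
    + specialize (Hv _ Hrep). rewrite (represents_scanned _ _ Hrep) in *.
      destruct (s r =? 0); apply Hv.
    + now apply represents_rewrite.
  - apply reach_step. rewrite (node_step O T l q _ ts Hq Hnd HT Hsc). do 2 f_equal.
    simpl. specialize (Hrep r Hr).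
    change 0 with (scanned (unary 0)) at 1. rewrite map_nth.
    rewrite (represents_scanned _ _ Hrep). destruct (s r =? 0); reflexivity.
Qed.

Lemma node_reach_same O T l s ts q r q1 q0 :
  q <> 1 -> nth_error l q = Some (Node r (1, Stay) q1 (0, Stay) q0) -> r < T ->
  tapes_represent T s ts ->
  exists ts', tapes_represent T s ts' /\
    reach O (node_machine T l) (Config q ts) (Config (if s r =? 0 then q0 else q1) ts').
Proof.
  intros Hq Hnd Hr Hts.
  destruct (node_reach O T l s ts q r _ q1 _ q0 (s r) Hq Hnd Hr Hts) as (ts' & H1 & H2).
  - intros t Ht. pose proof (represents_rewrite _ _ Ht) as H.
    rewrite (represents_scanned _ _ Ht) in *. destruct (s r =? 0); exact H.
  - exists ts'. split; [|exact H2]. replace s with (upd s r (s r)); [exact H1|].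
    apply functional_extensionality. intros x. unfold upd.
    destruct (Nat.eqb_spec x r) as [->|]; reflexivity.
Qed.

Definition code_at (l : list node) (s : nat) (p : list node) : Prop :=
  forall i nd, nth_error p i = Some nd -> nth_error l (s + i) = Some nd.

Lemma code_at_app l s p1 p2 :
  code_at l s (p1 ++ p2) -> code_at l s p1 /\ code_at l (s + length p1) p2.
Proof.
  intros H. split; intros i nd Hi.
  - apply H. rewrite nth_error_app1; [exact Hi|]. apply nth_error_Some. congruence.
  - rewrite <- Nat.add_assoc. apply H. rewrite nth_error_app2 by lia.
    now replace (length p1 + i - length p1) with i by lia.
Qed.

Lemma code_at_cons l s nd p :
  code_at l s (nd :: p) -> nth_error l s = Some nd /\ code_at l (s + 1) p.
Proof.
  intros H. split.
  - rewrite <- (Nat.add_0_r s). now apply H.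
  - intros i nd' Hi. replace (s + 1 + i) with (s + S i) by lia. now apply H.
Qed.

(** Induction on the execution, which covers exactly the terminating runs. The code may sit anywhere
    in a larger program, and [1 < q] keeps it off the query state. *)
Lemma comp_correct O T l c s s' :
  exec c s s' ->
  forall q ts, regs_below T c -> 1 < q -> code_at l q (comp c q) ->
  tapes_represent T s ts ->
  exists ts', tapes_represent T s' ts' /\
    reach O (node_machine T l) (Config q ts) (Config (q + length (comp c q)) ts').
Proof.
  induction 1 as [r s|r s|c1 c2 s s1 s2 _ IH1 _ IH2|r c s Hr|r c s s1 s2 Hr _ IH1 _ IH2];
    intros q ts Hb Hq Hc Hts; simpl in Hb, Hc; assert (Hq1 : q <> 1) by lia.
  - apply code_at_cons in Hc as [Hc1 Hc]. apply code_at_cons in Hc as [Hc2 _].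
    destruct Hts as [HT Hrep].
    set (ts1 := node_tapes (Node r (1, MoveL) (q + 1) (0, MoveL) (q + 1)) ts).
    set (ts2 := node_tapes (Node r (1, Stay) (q + 2) (1, Stay) (q + 2)) ts1).
    (* Halfway through [Inc] the head scans the blank in front of the strokes, where [represents]
       fails in general, so tape [r] is described by hand. *)
    assert (H1 : forall k, k < T -> if k =? r then
        exists a b, nth k ts1 (unary 0) = Tape (repeat 0 a) (0 :: repeat 1 (s r) ++ repeat 0 b)
        else represents (nth k ts1 (unary 0)) (s k)).
    { intros k Hk. unfold ts1, node_tapes. rewrite nth_actions by lia. simpl.
      specialize (Hrep k Hk). destruct (Nat.eqb_spec k r) as [->|Hne].
      - destruct Hrep as (a & b & ->). destruct (s r) as [|n]; simpl.
        + exists (pred a), (S (pred b)). destruct a, b; reflexivity.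
        + exists (pred a), b. destruct a; reflexivity.
      - now apply represents_rewrite. }
    assert (HT1 : length ts1 = T) by (unfold ts1; rewrite length_node_tapes; exact HT).
    exists ts2. split; [split|].
    + unfold ts2. now rewrite length_node_tapes.
    + intros k Hk. unfold ts2, node_tapes. rewrite nth_actions by lia. simpl.
      specialize (H1 k Hk). unfold upd. destruct (k =? r).
      * destruct H1 as (a & b & ->). exists a, b. reflexivity.
      * now apply represents_rewrite.
    + eapply reach_trans; apply reach_step.
      * erewrite node_step; [reflexivity|lia|exact Hc1|exact HT|].
        now apply (tapes_represent_scanned T s).
      * simpl node_target. fold ts1.
        assert (Hsc : Forall (fun t => scanned t = 0 \/ scanned t = 1) ts1).
        { apply Forall_forall. intros t Ht.
          apply (In_nth _ _ (unary 0)) in Ht as (k & Hk & <-).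
          rewrite HT1 in Hk. specialize (H1 k Hk). destruct (k =? r).
          - destruct H1 as (a & b & ->). simpl; auto.
          - rewrite (represents_scanned _ _ H1). destruct (s k =? 0); auto. }
        replace (if nth r (map scanned ts) 0 =? 1 then q + 1 else q + 1) with (q + 1)
          by (destruct (nth r (map scanned ts) 0 =? 1); reflexivity).
        rewrite (node_step O T l (q + 1) _ ts1 ltac:(lia) Hc2 HT1 Hsc).
        fold ts2. simpl. destruct (nth r (map scanned ts1) 0 =? 1); reflexivity.
  - apply code_at_cons in Hc as [Hc1 _].
    destruct (node_reach O T l s ts q r (0, MoveR) (q + 1) (0, Stay) (q + 1) (pred (s r))) as (ts' & H1 & H2);
      [lia|exact Hc1|exact Hb|exact Hts| |].
    + intros t (a & b & ->). destruct (s r) as [|n]; simpl.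
      * exists a, (S (pred b)). destruct b; reflexivity.
      * exists (S a), b. reflexivity.
    + exists ts'. split; [exact H1|]. simpl. destruct (s r =? 0); exact H2.
  - apply code_at_app in Hc as [Hc1 Hc2]. destruct Hb as [Hb1 Hb2].
    destruct (IH1 q ts Hb1 Hq Hc1 Hts) as (ts1 & Ht1 & Hr1).
    destruct (IH2 (q + length (comp c1 q)) ts1 Hb2 ltac:(lia) Hc2 Ht1) as (ts2 & Ht2 & Hr2).
    exists ts2. split; [exact Ht2|]. simpl. rewrite length_app, Nat.add_assoc.
    eapply reach_trans; eauto.
  - destruct Hb as [Hb1 Hb2]. apply code_at_cons in Hc as [Hc1 _].
    destruct (node_reach_same O T l s ts q r _ _ Hq1 Hc1 Hb1 Hts) as (ts' & H1 & H2).
    exists ts'. split; [exact H1|]. rewrite Hr in H2. simpl in *.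
    rewrite length_app; simpl.
    now replace (q + S (length (comp c (q + 1)) + 1)) with (q + length (comp c (q + 1)) + 2) by lia.
  - pose proof Hc as Hc0. destruct Hb as [Hb1 Hb2]. apply code_at_cons in Hc as [Hc1 Hc2].
    apply code_at_app in Hc2 as [Hc2 Hc3]. apply code_at_cons in Hc3 as [Hc3 _].
    destruct (node_reach_same O T l s ts q r _ _ Hq1 Hc1 Hb1 Hts) as (ts1 & Ht1 & Hr1).
    rewrite (proj2 (Nat.eqb_neq _ _) Hr) in Hr1.
    destruct (IH1 (q + 1) ts1 Hb2 ltac:(lia) Hc2 Ht1) as (ts2 & Ht2 & Hr2).
    destruct (node_reach_same O T l s1 ts2 (q + 1 + length (comp c (q + 1))) 0 _ _ ltac:(lia) Hc3 ltac:(lia) Ht2) as (ts3 & Ht3 & Hr3).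
    destruct (IH2 q ts3 (conj Hb1 Hb2) Hq Hc0 Ht3) as (ts4 & Ht4 & Hr4).
    exists ts4. split; [exact Ht4|].
    eapply reach_trans; [exact Hr1|]. eapply reach_trans; [exact Hr2|].
    eapply reach_trans; [exact Hr3|]. destruct (s1 0 =? 0); exact Hr4.
Qed.

(** * Primitive recursive expressions *)

(** [Rec n z e] is primitive recursion; [e] sees the previous value, the counter
    and then the environment. [App2 f a b] evaluates [f] in the environment
    [[a; b]] only, so that no shifting of indices is ever needed. *)
Inductive expr :=
| V (i : nat)
| Zero
| Succ (e : expr)
| App2 (f a b : expr)
| Rec (n z e : expr).

Fixpoint ev (e : expr) (env : list nat) : nat :=
  match e with
  | V i => nth i env 0
  | Zero => 0
  | Succ e => S (ev e env)
  | App2 f a b => ev f [ev a env; ev b env]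
  | Rec n z e =>
      nat_rec (fun _ => nat) (ev z env) (fun m acc => ev e (acc :: m :: env)) (ev n env)
  end.

Definition Clear (r : nat) : com := While r (Dec r).
Definition Move (r r' : nat) : com := While r (Seq (Dec r) (Inc r')).
Definition Copy (r r' tmp : nat) : com :=
  Seq (While r (Seq (Dec r) (Seq (Inc r') (Inc tmp)))) (Move tmp r).

(** The result goes to register [t]; the registers above [t] are scratch space,
    zero before and after, and the variables are in the registers [vs]. *)
Fixpoint cmp (vs : list nat) (t : nat) (e : expr) : com :=
  match e with
  | V i => match nth_error vs i with Some v => Copy v t (t + 1) | None => Clear t end
  | Zero => Clear t
  | Succ e => Seq (cmp vs t e) (Inc t)
  | App2 f a b =>
      Seq (cmp vs t a) (Seq (cmp vs (t + 1) b) (Seq (cmp [t; t + 1] (t + 2) f)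
        (Seq (Clear t) (Seq (Clear (t + 1)) (Move (t + 2) t)))))
  | Rec n z e =>
      Seq (cmp vs t n) (Seq (cmp vs (t + 2) z)
        (Seq (While t (Seq (Dec t) (Seq (cmp (t + 2 :: t + 1 :: vs) (t + 3) e)
                (Seq (Clear (t + 2)) (Seq (Move (t + 3) (t + 2)) (Inc (t + 1)))))))
        (Seq (Clear (t + 1)) (Move (t + 2) t))))
  end.

Lemma exec_eq c s s1 s2 : exec c s s1 -> (forall r, s1 r = s2 r) -> exec c s s2.
Proof. intros H E. apply functional_extensionality in E. now subst. Qed.

Ltac upd_ext :=
  intros; unfold upd;
  repeat match goal with |- context [?x =? ?y] => destruct (Nat.eqb_spec x y) end;
  subst; try lia; auto.

Lemma exec_clear r s : exec (Clear r) s (upd s r 0).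
Proof.
  remember (s r) as n eqn:E. revert s E; induction n as [|n IH]; intros s E.
  - eapply exec_eq; [apply exec_done; congruence|]. upd_ext.
  - eapply exec_eq; [eapply exec_loop; [congruence|apply exec_dec|apply IH]|].
    + rewrite upd_eq. lia.
    + upd_ext.
Qed.

Lemma exec_move r r' s : r <> r' -> exec (Move r r') s (upd (upd s r 0) r' (s r' + s r)).
Proof.
  intros Hne. remember (s r) as n eqn:E. revert s E; induction n as [|n IH]; intros s E.
  - eapply exec_eq; [apply exec_done; congruence|]. upd_ext.
  - eapply exec_eq;
      [eapply exec_loop; [congruence|eapply exec_seq; [apply exec_dec|apply exec_inc]|apply IH]|].
    + upd_ext.
    + upd_ext.
Qed.

Lemma exec_copy_loop r r' r'' s : r <> r' -> r <> r'' -> r' <> r'' ->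
  exec (While r (Seq (Dec r) (Seq (Inc r') (Inc r'')))) s
    (upd (upd (upd s r 0) r' (s r' + s r)) r'' (s r'' + s r)).
Proof.
  intros H1 H2 H3. remember (s r) as n eqn:E. revert s E; induction n as [|n IH]; intros s E.
  - eapply exec_eq; [apply exec_done; congruence|]. upd_ext.
  - eapply exec_eq; [eapply exec_loop; [congruence| |apply IH]|].
    + eapply exec_seq; [apply exec_dec|eapply exec_seq; apply exec_inc].
    + upd_ext.
    + upd_ext.
Qed.

Lemma exec_copy r r' tmp s : r <> r' -> r <> tmp -> r' <> tmp -> s r' = 0 -> s tmp = 0 ->
  exec (Copy r r' tmp) s (upd s r' (s r)).
Proof.
  intros H1 H2 H3 E1 E2. eapply exec_eq.
  - eapply exec_seq; [now apply exec_copy_loop|now apply exec_move, not_eq_sym].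
  - upd_ext.
Qed.

Lemma map_upd s t v vs : (forall r, In r vs -> r < t) -> map (upd s t v) vs = map s vs.
Proof.
  intros H. apply map_ext_in. intros r Hr. apply upd_neq. specialize (H r Hr). lia.
Qed.

Lemma cmp_correct e : forall vs t s,
  (forall r, In r vs -> r < t) -> (forall r, t <= r -> s r = 0) ->
  exec (cmp vs t e) s (upd s t (ev e (map s vs))).
Proof.
  induction e as [i| |e IH|f IHf a IHa b IHb|n IHn z IHz e IHe]; intros vs t s Hvs Hs; simpl.
  - destruct (nth_error vs i) as [v|] eqn:E.
    + assert (v < t) by (apply Hvs; eapply nth_error_In; eauto).
      eapply exec_eq; [apply exec_copy; try lia; apply Hs; lia|].
      enough (nth i (map s vs) 0 = s v) as -> by auto.
      apply nth_error_nth. now rewrite nth_error_map, E.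
    + eapply exec_eq; [apply exec_clear|]. apply nth_error_None in E.
      rewrite nth_overflow; [auto|now rewrite length_map].
  - apply exec_clear.
  - eapply exec_eq; [eapply exec_seq; [apply IH; auto|apply exec_inc]|]. upd_ext.
  - set (x := ev a (map s vs)). set (y := ev b (map s vs)).
    set (s1 := upd s t x). set (s2 := upd s1 (t + 1) y).
    assert (E2 : exec (cmp vs (t + 1) b) s1 s2).
    { unfold s2, y. replace (map s vs) with (map s1 vs) by (apply map_upd; auto).
      apply IHb; [intros r Hr; specialize (Hvs r Hr); lia|].
      intros r Hr. unfold s1. rewrite upd_neq by lia. apply Hs. lia. }
    assert (E3 : exec (cmp [t; t + 1] (t + 2) f) s2 (upd s2 (t + 2) (ev f [x; y]))).
    { replace [x; y] with (map s2 [t; t + 1]).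
      - apply IHf; [simpl; intros; lia|]. intros r Hr. unfold s2, s1.
        rewrite !upd_neq by lia. apply Hs. lia.
      - simpl. unfold s2, s1. rewrite upd_eq, upd_neq, upd_eq by lia. reflexivity. }
    eapply exec_eq.
    + eapply exec_seq; [apply IHa; auto|]. eapply exec_seq; [exact E2|].
      eapply exec_seq; [exact E3|]. eapply exec_seq; [apply exec_clear|].
      eapply exec_seq; [apply exec_clear|]. apply exec_move. lia.
    + intros r. unfold s2, s1. pose proof (Hs (t + 1)). pose proof (Hs (t + 2)). upd_ext.
  - set (N := ev n (map s vs)). set (z0 := ev z (map s vs)).
    set (F := nat_rec (fun _ => nat) z0 (fun m acc => ev e (acc :: m :: map s vs))).
    (* Loop invariant: register [t] holds the [k] rounds left, [t + 1] the [m] rounds done, and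
       [t + 2] the value reached by them. *)
    set (st := fun k m => upd (upd (upd s t k) (t + 1) m) (t + 2) (F m)).
    assert (E2 : exec (cmp vs (t + 2) z) (upd s t N) (st N 0)).
    { eapply exec_eq; [apply IHz|].
      - intros r Hr; specialize (Hvs r Hr); lia.
      - intros r Hr. rewrite upd_neq by lia. apply Hs; lia.
      - intros r. rewrite map_upd by auto. unfold st. pose proof (Hs (t + 1)). upd_ext. }
    assert (Hst : forall k m, map (st k m) vs = map s vs).
    { intros k m. unfold st. rewrite !map_upd; auto;
        intros r Hr; specialize (Hvs r Hr); lia. }
    assert (Loop : forall k m, exec (While t (Seq (Dec t) (Seq (cmp (t + 2 :: t + 1 :: vs) (t + 3) e)
                (Seq (Clear (t + 2)) (Seq (Move (t + 3) (t + 2)) (Inc (t + 1)))))))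
                (st k m) (st 0 (k + m))).
    { induction k as [|k IHk]; intros m.
      - apply exec_done. unfold st. upd_ext.
      - eapply exec_loop; [unfold st; upd_ext| |].
        + eapply exec_eq.
          * eapply exec_seq; [apply exec_dec|]. eapply exec_seq.
            { replace (upd (st (S k) m) t (pred (st (S k) m t))) with (st k m)
                by (apply functional_extensionality; unfold st; upd_ext).
              apply IHe.
              - simpl. intros r [<-|[<-|Hr]]; [lia|lia|specialize (Hvs r Hr); lia].
              - intros r Hr. unfold st. rewrite !upd_neq by lia. apply Hs; lia. }
            eapply exec_seq; [apply exec_clear|].
            eapply exec_seq; [apply exec_move; lia|apply exec_inc].
          * instantiate (1 := st k (S m)). simpl map. rewrite Hst.
            assert (st k m (t + 2) = F m) as -> by (unfold st; upd_ext).
            assert (st k m (t + 1) = m) as -> by (unfold st; upd_ext).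
            change (ev e (F m :: m :: map s vs)) with (F (S m)).
            intros r. unfold st. pose proof (Hs (t + 3)). upd_ext.
        + replace (S k + m) with (k + S m) by lia. apply IHk. }
    eapply exec_eq.
    + eapply exec_seq; [apply IHn; auto|]. eapply exec_seq; [exact E2|].
      eapply exec_seq; [apply Loop|]. eapply exec_seq; [apply exec_clear|].
      apply exec_move. lia.
    + intros r. rewrite Nat.add_0_r. change (nat_rec (fun _ => nat) z0 _ N) with (F N).
      unfold st. pose proof (Hs (t + 1)). pose proof (Hs (t + 2)). upd_ext.
Qed.

(** The state following a query is fixed, so the only query is made at the start. *)
Definition expr_nodes (e : expr) : list node :=
  let pre := comp (While 0 (Seq (Dec 0) (Seq (Inc 1) (Inc 2)))) 3 in
  let main := Seq (cmp [1; 2] 3 e) (Move 3 0) in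
  goto 3 :: goto 3 :: goto (length pre + 4)
    :: pre ++ goto query_state :: comp main (length pre + 4).

(** The input is copied to tape 1, the query tape, and to tape 2; after the query these tapes hold
    [O n] and [n], the environment of [e]. Addresses 0, 1 and 2 of the program are the start, query
    and answer states. The node at 1 is a placeholder, since the query state does not consult the
    program, and the one at 2 jumps behind the copying loop. *)
Lemma expr_machine e :
  exists M, forall O n, computes M O n (ev e [O n; n]).
Proof.
  set (pre := While 0 (Seq (Dec 0) (Seq (Inc 1) (Inc 2)))).
  set (main := Seq (cmp [1; 2] 3 e) (Move 3 0)).
  destruct (regs_below_ex main) as [T0 HT0]. set (T := max T0 3).
  assert (Hmain : regs_below T main) by (apply (regs_below_mono T0); [unfold T; lia|auto]).
  assert (Hpre : regs_below T pre) by (unfold T; simpl; lia).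
  exists (node_machine T (expr_nodes e)). intros O n.
  set (l := expr_nodes e).
  assert (Hl : code_at l 0 l) by (intros i nd H; exact H).
  unfold l at 2, expr_nodes in Hl. fold pre main in Hl.
  set (P := length (comp pre 3)) in *.
  apply code_at_cons in Hl as [Hl0 Hl]. apply code_at_cons in Hl as [_ Hl].
  apply code_at_cons in Hl as [Hl2 Hl]. apply code_at_app in Hl as [Hlp Hl].
  apply code_at_cons in Hl as [Hlq Hl]. simpl in Hl0, Hl2, Hlp. fold P in Hlq, Hl.
  replace (0 + 1 + 1 + 1 + P + 1) with (P + 4) in Hl by lia.
  assert (Hlen : length l = P + 4 + length (comp main (P + 4))).
  { unfold l, expr_nodes. fold pre main P. simpl. rewrite length_app. fold P. simpl. lia. }
  set (s0 := upd (fun _ => 0) 0 n).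
  assert (H0 : tapes_represent T s0 (tapes (init (node_machine T l) n))).
  { simpl. split; [simpl; rewrite repeat_length; unfold T; lia|]. intros r Hr.
    unfold s0, upd. destruct r as [|[|r]]; simpl; try apply represents_unary.
    rewrite nth_repeat. apply represents_unary. }
  destruct (node_reach_same O T l s0 _ 0 0 3 3 ltac:(lia) Hl0 ltac:(unfold T; lia) H0)
    as (ts1 & Ht1 & Hr1).
  destruct (comp_correct O T l pre s0 _ (exec_copy_loop 0 1 2 s0 ltac:(lia) ltac:(lia) ltac:(lia))
    3 ts1 Hpre ltac:(lia) Hlp Ht1) as (ts2 & Ht2 & Hr2). fold P in Hr2.
  change (s0 0) with n in Hr1, Ht2.
  change (s0 1 + n) with n in Ht2. change (s0 2 + n) with n in Ht2.
  destruct (node_reach_same O T l _ ts2 (3 + P) 0 _ _ ltac:(lia) Hlq ltac:(unfold T; lia) Ht2)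
    as (ts3 & Ht3 & Hr3).
  set (s3 := upd (upd (upd s0 0 0) 1 n) 2 n) in *.
  set (s4 := upd s3 1 (O n)).
  assert (H4 : tapes_represent T s4 (query O ts3) /\
    reach O (node_machine T l) (Config 1 ts3) (Config 2 (query O ts3))).
  { split; [|apply reach_step; reflexivity]. destruct Ht3 as [HT Hrep].
    destruct ts3 as [|t0 [|t1 ts3]]; [simpl in HT; unfold T in HT; lia..|].
    split; [exact HT|]. intros r Hr. specialize (Hrep r Hr) as Hrep'.
    destruct r as [|[|r]]; simpl in Hrep' |- *; [exact Hrep'| |exact Hrep'].
    unfold s4. rewrite upd_eq.
    assert (strokes t1 = n) as ->.
    { apply represents_strokes. apply (Hrep 1). unfold T; lia. }
    apply represents_unary. }
  destruct H4 as [Ht4 Hr4].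
  destruct (node_reach_same O T l s4 _ 2 0 _ _ ltac:(lia) Hl2 ltac:(unfold T; lia) Ht4)
    as (ts5 & Ht5 & Hr5).
  assert (Hex : exec main s4 (upd (upd s4 3 0) 0 (ev e [O n; n]))).
  { eapply exec_eq.
    - eapply exec_seq; [apply cmp_correct|apply exec_move; lia].
      + simpl. lia.
      + intros r Hr. unfold s4, s3, s0. rewrite !upd_neq by lia. reflexivity.
    - change (map s4 [1; 2]) with [O n; n]. intros r.
      change ((upd s4 3 (ev e [O n; n])) 3) with (ev e [O n; n]).
      change ((upd s4 3 (ev e [O n; n])) 0) with 0. upd_ext. }
  destruct (comp_correct O T l main _ _ Hex (P + 4) ts5 Hmain ltac:(lia) Hl Ht5)
    as (ts6 & Ht6 & Hr6).
  assert (Hr : reach O (node_machine T l) (init (node_machine T l) n) (Config (length l) ts6)).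
  { rewrite Hlen. eapply reach_trans; [|exact Hr6].
    replace (if s4 0 =? 0 then P + 4 else P + 4) with (P + 4) in Hr5
      by (destruct (s4 0 =? 0); reflexivity).
    eapply reach_trans; [|exact Hr5]. eapply reach_trans; [|exact Hr4].
    replace (if s3 0 =? 0 then query_state else query_state) with 1 in Hr3
      by (destruct (s3 0 =? 0); reflexivity).
    eapply reach_trans; [|exact Hr3]. eapply reach_trans; [|exact Hr2].
    replace (if n =? 0 then 3 else 3) with 3 in Hr1 by (destruct (n =? 0); reflexivity).
    exact Hr1. }
  destruct Hr as [k Hk]. exists k. fold l. rewrite Hk. split.
  - apply node_halt. lia.
  - unfold output; simpl. destruct Ht6 as [HT6 Hrep6].
    destruct ts6 as [|t ts6]; [simpl in HT6; unfold T in HT6; lia|]. simpl.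
    apply represents_strokes. apply (Hrep6 0). unfold T; lia.
Qed.

(** * Arithmetic of codes *)

Fixpoint const (n : nat) : expr :=
  match n with 0 => Zero | S n => Succ (const n) end.

Definition Plus (a b : expr) : expr := Rec a b (Succ (V 0)).
Definition Pred (a : expr) : expr := Rec a Zero (V 1).
Definition Sub (a b : expr) : expr := Rec b a (Pred (V 0)).
Definition Times (a b : expr) : expr := App2 (Rec (V 0) Zero (Plus (V 0) (V 3))) a b.
Definition Pow (b : nat) (n : expr) : expr := Rec n (const 1) (Times (const b) (V 0)).
Definition Min (a b : expr) : expr := Sub a (Sub a b).
(** Division by counting: in round [m] the quotient [q] goes up by one exactly when
    [S q * b <= S m], a test that truncated subtraction turns into 0 or 1. *)
Definition Div (a b : expr) : expr :=
  App2 (Rec (V 0) Zero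
    (Plus (V 0) (Sub (const 1) (Sub (Times (Succ (V 0)) (V 3)) (Succ (V 1)))))) a b.
Definition Tri (a : expr) : expr := Rec a Zero (Plus (Succ (V 1)) (V 0)).
Definition Pair (a b : expr) : expr := App2 (Plus (V 1) (Tri (Plus (V 1) (V 0)))) a b.
(** The diagonal of Cantor's enumeration on which [a] lies, that is the greatest [w] with
    [tri w <= a], found by the counting of [Div]. On it the second component is the offset from
    [tri w], and the components add up to [w]. *)
Definition Diag (a : expr) : expr :=
  Rec a Zero (Plus (V 0) (Sub (const 1) (Sub (Tri (Succ (V 0))) (Succ (V 1))))).
Definition Fst (a : expr) : expr :=
  App2 (Sub (V 1) (Sub (V 0) (Tri (V 1)))) a (Diag a).
Definition Snd (a : expr) : expr := App2 (Sub (V 0) (Tri (V 1))) a (Diag a).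

Definition tri (n : nat) : nat := nat_rec (fun _ => nat) 0 (fun i m => S i + m) n.

(** Evaluates variables and successors only: full simplification would open the derived operations
    and hide them from the [ev_] lemmas. *)
Ltac ev_vars :=
  cbn [nat_rec nat_rect] in *; repeat match goal with
  | |- context [ev (V ?i) ?l] => let v := eval cbn [nth] in (nth i l 0) in change (ev (V i) l) with v
  | |- context [ev (Succ ?e) ?l] => change (ev (Succ e) l) with (S (ev e l))
  end; unfold nat_rec in *.

Lemma ev_const n env : ev (const n) env = n.
Proof. induction n; simpl; congruence. Qed.

Lemma ev_Plus a b env : ev (Plus a b) env = ev a env + ev b env.
Proof. simpl. induction (ev a env); simpl; congruence. Qed.

Lemma ev_Pred a env : ev (Pred a) env = pred (ev a env).
Proof. simpl. destruct (ev a env); reflexivity. Qed.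

Lemma ev_Sub a b env : ev (Sub a b) env = ev a env - ev b env.
Proof.
  change (ev (Sub a b) env) with
    (nat_rec (fun _ => nat) (ev a env) (fun m acc => ev (Pred (V 0)) (acc :: m :: env)) (ev b env)).
  induction (ev b env) as [|n IH]; cbn [nat_rec nat_rect]; [lia|].
  rewrite ev_Pred. ev_vars. rewrite IH. lia.
Qed.

Lemma ev_Times a b env : ev (Times a b) env = ev a env * ev b env.
Proof.
  unfold Times. cbn [ev nth].
  enough (H : forall x y n, nat_rec (fun _ => nat) 0
    (fun m acc => ev (Plus (V 0) (V 3)) [acc; m; x; y]) n = n * y) by apply H.
  intros x y. induction n as [|n IH]; cbn [nat_rec nat_rect]; [reflexivity|].
  rewrite ev_Plus. ev_vars. rewrite IH. lia.
Qed.

Lemma ev_Pow b n env : ev (Pow b n) env = b ^ ev n env.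
Proof.
  unfold Pow. cbn [ev nth]. induction (ev n env) as [|k IH]; cbn [nat_rec nat_rect].
  - apply ev_const.
  - rewrite ev_Times, ev_const. ev_vars. rewrite IH. reflexivity.
Qed.

Lemma ev_Min a b env : ev (Min a b) env = min (ev a env) (ev b env).
Proof. unfold Min. rewrite !ev_Sub. lia. Qed.

Lemma ev_Div a b env : ev b env <> 0 -> ev (Div a b) env = ev a env / ev b env.
Proof.
  intros Hb. unfold Div. cbn [ev nth].
  enough (H : forall z y x, y <> 0 -> nat_rec (fun _ => nat) 0
    (fun m acc => ev (Plus (V 0) (Sub (const 1) (Sub (Times (Succ (V 0)) (V 3)) (Succ (V 1)))))
       [acc; m; z; y]) x = x / y) by (apply H; exact Hb).
  clear Hb. intros z y x Hy. induction x as [|x IH]; cbn [nat_rec nat_rect]; [now rewrite Nat.Div0.div_0_l|].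
  rewrite ev_Plus, ev_Sub, ev_const, ev_Sub, ev_Times. ev_vars. rewrite IH.
  pose proof (Nat.div_mod_eq x y). pose proof (Nat.mod_upper_bound x y Hy).
  destruct (Nat.eq_dec (S (x mod y)) y) as [E|E].
  - apply (Nat.div_unique _ _ _ 0); nia.
  - apply (Nat.div_unique _ _ _ (S (x mod y))); nia.
Qed.

Lemma ev_Tri a env : ev (Tri a) env = tri (ev a env).
Proof.
  unfold Tri, tri. cbn [ev nth]. induction (ev a env) as [|n IH]; cbn [nat_rec nat_rect]; [reflexivity|].
  rewrite ev_Plus. ev_vars. rewrite IH. reflexivity.
Qed.

Lemma ev_Pair a b env : ev (Pair a b) env = pairn (ev a env) (ev b env).
Proof. unfold Pair. cbn [ev]. rewrite ev_Plus, ev_Tri, ev_Plus. reflexivity. Qed.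

Lemma pairn_tri x y : pairn x y = y + tri (y + x).
Proof. reflexivity. Qed.

Lemma ev_Diag a env x y : ev a env = pairn x y -> ev (Diag a) env = y + x.
Proof.
  intros E. rewrite pairn_tri in E.
  assert (H : forall n w, tri w <= n < tri (S w) ->
    nat_rec (fun _ => nat) 0 (fun m acc =>
      ev (Plus (V 0) (Sub (const 1) (Sub (Tri (Succ (V 0))) (Succ (V 1))))) (acc :: m :: env)) n = w).
  { induction n as [|n IH]; intros w Hw.
    - destruct w; [reflexivity|]. simpl in Hw. lia.
    - cbn [nat_rec nat_rect]. rewrite ev_Plus, ev_Sub, ev_const, ev_Sub, ev_Tri. ev_vars.
      destruct (Nat.eq_dec (S n) (tri w)) as [E'|E'].
      + destruct w as [|w]; [simpl in E'; lia|]. rewrite (IH w) by (simpl in *; lia). lia.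
      + rewrite (IH w) by lia. lia. }
  unfold Diag. cbn [ev nth]. apply H. rewrite E. simpl. lia.
Qed.

Lemma ev_Fst a env x y : ev a env = pairn x y -> ev (Fst a) env = x.
Proof.
  intros E. unfold Fst. cbn [ev]. rewrite ev_Sub, ev_Sub, ev_Tri. cbn [ev nth].
  rewrite (ev_Diag _ _ _ _ E), E, pairn_tri. lia.
Qed.

Lemma ev_Snd a env x y : ev a env = pairn x y -> ev (Snd a) env = y.
Proof.
  intros E. unfold Snd. cbn [ev]. rewrite ev_Sub, ev_Tri. cbn [ev nth].
  rewrite (ev_Diag _ _ _ _ E), E, pairn_tri. lia.
Qed.

Lemma pairn_inj x y x' y' : pairn x y = pairn x' y' -> x = x' /\ y = y'.
Proof. intros H. apply (Cantor.to_nat_inj (x, y) (x', y')) in H. now injection H. Qed.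

(** * Distance to a locally refined grid *)

Local Open Scope R_scope.

Definition dist_Z (y : R) : R :=
  Rmin (y - IZR (Int_part y)) (IZR (Int_part y) + 1 - y).

(** At the right end [y = k + 1] the integer part jumps, but both formulas give 0 there. *)
Lemma dist_Z_between y k : IZR k <= y <= IZR k + 1 -> dist_Z y = Rmin (y - IZR k) (IZR k + 1 - y).
Proof.
  intros H. unfold dist_Z. destruct (base_Int_part y) as [H1 H2].
  assert (Hk : Int_part y = k \/ Int_part y = (k + 1)%Z).
  { assert (IZR k < IZR (Int_part y + 1)) by (rewrite plus_IZR; lra).
    assert (IZR (Int_part y) < IZR (k + 2)) by (rewrite plus_IZR; lra).
    apply lt_IZR in H0, H3. lia. }
  destruct Hk as [-> | E]; [reflexivity|]. rewrite E, plus_IZR in *.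
  rewrite Rmin_left by lra. rewrite Rmin_right by lra. lra.
Qed.

(** With [dist_Z_attained] this describes [dist_Z] as a minimum over all integers, which yields the
    Lipschitz bound and the periodicity without looking at integer parts. *)
Lemma dist_Z_le y k : dist_Z y <= Rabs (y - IZR k).
Proof.
  unfold dist_Z. destruct (base_Int_part y) as [H1 H2].
  destruct (Z_le_gt_dec k (Int_part y)) as [H|H].
  - apply IZR_le in H. eapply Rle_trans; [apply Rmin_l|]. rewrite Rabs_right; lra.
  - assert (H' : (Int_part y + 1 <= k)%Z) by lia. apply IZR_le in H'. rewrite plus_IZR in H'.
    eapply Rle_trans; [apply Rmin_r|]. rewrite Rabs_left1; lra.
Qed.

Lemma dist_Z_attained y : exists k, dist_Z y = Rabs (y - IZR k).
Proof.
  unfold dist_Z. destruct (base_Int_part y) as [H1 H2].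
  unfold Rmin. destruct (Rle_dec _ _).
  - exists (Int_part y). rewrite Rabs_right; lra.
  - exists (Int_part y + 1)%Z. rewrite plus_IZR, Rabs_left1; lra.
Qed.

Lemma dist_Z_pos y : 0 <= dist_Z y.
Proof. destruct (dist_Z_attained y) as [k ->]. apply Rabs_pos. Qed.

Lemma dist_Z_IZR k : dist_Z (IZR k) = 0.
Proof.
  apply Rle_antisym; [|apply dist_Z_pos].
  eapply Rle_trans; [apply (dist_Z_le _ k)|]. rewrite Rminus_diag, Rabs_R0. lra.
Qed.

Lemma dist_Z_half y : dist_Z y <= / 2.
Proof. unfold dist_Z, Rmin. destruct (Rle_dec _ _); lra. Qed.

Lemma dist_Z_lipschitz1 y z : dist_Z y - dist_Z z <= Rabs (y - z).
Proof.
  destruct (dist_Z_attained z) as [k ->]. pose proof (dist_Z_le y k).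
  pose proof (Rabs_triang (y - z) (z - IZR k)).
  replace (y - z + (z - IZR k)) with (y - IZR k) in H0 by ring. lra.
Qed.

Lemma dist_Z_lipschitz y z : Rabs (dist_Z y - dist_Z z) <= Rabs (y - z).
Proof.
  pose proof (dist_Z_lipschitz1 y z). pose proof (dist_Z_lipschitz1 z y).
  rewrite (Rabs_minus_sym z y) in H0. unfold Rabs at 1. destruct (Rcase_abs _); lra.
Qed.

(** Since [1/n - 1/(n+1) = 1/(n(n+1))], the cell consists of exactly [B ^ n] meshes, and both of its
    ends are multiples of the mesh. *)
Definition density (B n : nat) : nat := (n * (n + 1) * B ^ n)%nat.

(** For [1 / (n + 1) <= x <= 1 / n] this is the distance of [x] to the multiples
    of [1 / density B n], which include the two ends of the interval. *)
Definition grid_dist (B : nat) (x : R) : R :=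
  if Rle_dec x 0 then 0 else if Rle_dec 1 x then 0 else
  let d := INR (density B (Z.to_nat (Int_part (/ x)))) in dist_Z (x * d) / d.

Definition in_cell (n : nat) (x : R) : Prop := (1 <= n)%nat /\ / (INR n + 1) <= x <= / INR n.

Lemma density_pos B n : (1 <= B)%nat -> (1 <= n)%nat -> 0 < INR (density B n).
Proof.
  intros HB Hn. apply lt_0_INR. unfold density.
  pose proof (Nat.pow_nonzero B n ltac:(lia)). nia.
Qed.

Lemma INR_density B n : INR (density B n) = INR n * (INR n + 1) * INR (B ^ n).
Proof. unfold density. rewrite !mult_INR, plus_INR. reflexivity. Qed.

Lemma in_cell_inv n x : in_cell n x -> 0 < x <= 1 /\ INR n <= / x <= INR n + 1 /\ 1 <= INR n.
Proof.
  intros [Hn [H1 H2]]. apply le_INR in Hn. change (INR 1) with 1 in Hn.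
  assert (0 < / (INR n + 1)) by (apply Rinv_0_lt_compat; lra).
  assert (/ INR n <= 1) by (rewrite <- Rinv_1; apply Rinv_le_contravar; lra).
  repeat split; try lra.
  - rewrite <- (Rinv_inv (INR n)). apply Rinv_le_contravar; lra.
  - rewrite <- (Rinv_inv (INR n + 1)). apply Rinv_le_contravar; lra.
Qed.

Lemma in_cell_ex x : 0 < x < 1 -> exists n, in_cell n x /\ / (INR n + 1) < x.
Proof.
  intros Hx. destruct (base_Int_part (/ x)) as [H1 H2].
  assert (H3 : 1 < / x) by (rewrite <- Rinv_1; apply Rinv_lt_contravar; lra).
  assert (Hk : (1 <= Int_part (/ x))%Z).
  { assert (IZR 0 < IZR (Int_part (/ x))) by lra. apply lt_IZR in H. lia. }
  exists (Z.to_nat (Int_part (/ x))). unfold in_cell.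
  rewrite INR_IZR_INZ, Z2Nat.id by lia. apply IZR_le in Hk.
  assert (/ (IZR (Int_part (/ x)) + 1) < x).
  { rewrite <- (Rinv_inv x) at 2. apply Rinv_lt_contravar; [|lra].
    apply Rmult_lt_0_compat; lra. }
  repeat split; try lra.
  - apply le_IZR in Hk. lia.
  - rewrite <- (Rinv_inv x) at 1. apply Rinv_le_contravar; lra.
Qed.

Lemma cell_ends B n : (1 <= n)%nat ->
  / (INR n + 1) * INR (density B n) = IZR (Z.of_nat (n * B ^ n)) /\
  / INR n * INR (density B n) = IZR (Z.of_nat ((n + 1) * B ^ n)).
Proof.
  intros Hn. rewrite <- !INR_IZR_INZ, INR_density, !mult_INR, plus_INR. change (INR 1) with 1.
  apply le_INR in Hn. change (INR 1) with 1 in Hn. split; field; lra.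
Qed.

(** The definition picks the cell by an integer part and so assigns the left end [1/(n+1)] to the
    next cell. A common end is a grid point for both meshes, so both formulas give 0 there; likewise
    at 1. *)
Lemma grid_dist_cell B n x : (1 <= B)%nat -> in_cell n x ->
  grid_dist B x = dist_Z (x * INR (density B n)) / INR (density B n).
Proof.
  intros HB Hc. destruct (in_cell_inv _ _ Hc) as (Hx & Hi & Hn). destruct Hc as [Hn1 Hc].
  unfold grid_dist. destruct (Rle_dec x 0) as [|_]; [lra|].
  destruct (Rle_dec 1 x) as [H1|H1].
  - assert (x = 1) by lra. subst x. rewrite Rinv_1 in Hi.
    assert (E : INR n = 1) by lra.
    rewrite Rmult_1_l, INR_IZR_INZ, dist_Z_IZR. unfold Rdiv. ring.
  - destruct (base_Int_part (/ x)) as [H2 H3].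
    assert (Hk : Int_part (/ x) = Z.of_nat n \/ Int_part (/ x) = Z.of_nat (n + 1)).
    { rewrite INR_IZR_INZ in Hi.
      assert (IZR (Z.of_nat n) < IZR (Int_part (/ x) + 1)) by (rewrite plus_IZR; lra).
      assert (IZR (Int_part (/ x)) <= IZR (Z.of_nat n + 1)) by (rewrite plus_IZR; lra).
      apply lt_IZR in H. apply le_IZR in H0. lia. }
    destruct Hk as [-> | E]; [now rewrite Nat2Z.id|].
    rewrite E, Nat2Z.id. rewrite E, <- INR_IZR_INZ, plus_INR in H2. change (INR 1) with 1 in H2.
    assert (Ex : x = / (INR n + 1)) by (rewrite <- (Rinv_inv x); f_equal; lra).
    rewrite Ex. rewrite (proj1 (cell_ends B n Hn1)), dist_Z_IZR.
    assert (E1 : INR n + 1 = INR (n + 1)) by (rewrite plus_INR; reflexivity).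
    rewrite E1, (proj2 (cell_ends B (n + 1) ltac:(lia))), dist_Z_IZR. unfold Rdiv; ring.
Qed.

(** The ends are grid points, so the distance to either of them bounds the distance to the grid.
    This carries the Lipschitz bound across cells of different mesh. *)
Lemma grid_dist_bounds B n x : (1 <= B)%nat -> in_cell n x ->
  0 <= grid_dist B x <= Rmin (x - / (INR n + 1)) (/ INR n - x).
Proof.
  intros HB Hc. rewrite (grid_dist_cell B n x HB Hc). destruct Hc as [Hn Hc].
  pose proof (density_pos B n HB Hn) as Hm. destruct (cell_ends B n Hn) as [E1 E2].
  set (d := INR (density B n)) in *. split.
  - apply Rmult_le_pos; [apply dist_Z_pos|]. left. now apply Rinv_0_lt_compat.
  - apply Rmin_glb; apply (Rmult_le_reg_r d); try lra; unfold Rdiv;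
      rewrite Rmult_assoc, Rinv_l, Rmult_1_r by lra.
    + eapply Rle_trans; [apply (dist_Z_le _ (Z.of_nat (n * B ^ n)))|].
      rewrite <- E1, <- Rmult_minus_distr_r, Rabs_right; [lra|].
      apply Rle_ge, Rmult_le_pos; lra.
    + eapply Rle_trans; [apply (dist_Z_le _ (Z.of_nat ((n + 1) * B ^ n)))|].
      rewrite <- E2, <- Rmult_minus_distr_r, Rabs_left1; [lra|].
      assert (0 <= (/ INR n - x) * d) by (apply Rmult_le_pos; lra). lra.
Qed.

Lemma grid_dist_outside B x : x <= 0 \/ 1 <= x -> grid_dist B x = 0.
Proof.
  intros H. unfold grid_dist. destruct (Rle_dec x 0); [reflexivity|].
  destruct (Rle_dec 1 x); [reflexivity|lra].
Qed.

Lemma grid_dist_lipschitz_lt B x y : (1 <= B)%nat -> x < y ->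
  Rabs (grid_dist B x - grid_dist B y) <= y - x.
Proof.
  intros HB Hxy.
  assert (Hout : forall z, z <= 0 \/ 1 <= z \/ exists n, in_cell n z /\ / (INR n + 1) < z).
  { intros z. destruct (Rle_dec z 0); [auto|]. destruct (Rle_dec 1 z); [auto|].
    right; right. apply in_cell_ex. lra. }
  destruct (Hout x) as [Hx|[Hx|(n & Hn & Hn')]]; destruct (Hout y) as [Hy|[Hy|(m & Hm & Hm')]];
    try (rewrite !grid_dist_outside by auto; rewrite Rminus_diag, Rabs_R0; lra); try lra.
  - rewrite (grid_dist_outside B x) by auto.
    pose proof (grid_dist_bounds B m y HB Hm) as [H1 H2].
    pose proof (Rmin_l (y - / (INR m + 1)) (/ INR m - y)).
    assert (0 < / (INR m + 1)) by (apply Rinv_0_lt_compat; pose proof (pos_INR m); lra).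
    rewrite Rabs_left1; lra.
  - apply in_cell_inv in Hm. lra.
  - exfalso. apply in_cell_inv in Hn. lra.
  - rewrite (grid_dist_outside B y) by auto.
    pose proof (grid_dist_bounds B n x HB Hn) as [H1 H2].
    pose proof (Rmin_r (x - / (INR n + 1)) (/ INR n - x)).
    assert (/ INR n <= 1).
    { apply in_cell_inv in Hn. rewrite <- Rinv_1. apply Rinv_le_contravar; lra. }
    rewrite Rabs_right; lra.
  - destruct (in_cell_inv _ _ Hn) as (_ & _ & Hn1). destruct (in_cell_inv _ _ Hm) as (_ & _ & Hm1).
    destruct (lt_eq_lt_dec n m) as [[Hlt|<-]|Hlt].
    + exfalso. assert (INR (n + 1) <= INR m) by (apply le_INR; lia).
      rewrite plus_INR in H. change (INR 1) with 1 in H.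
      assert (/ INR m <= / (INR n + 1)) by (apply Rinv_le_contravar; lra).
      destruct Hm as [_ Hm]. lra.
    + rewrite (grid_dist_cell B n x HB Hn), (grid_dist_cell B n y HB Hm).
      pose proof (density_pos B n HB (proj1 Hn)) as Hd. set (d := INR (density B n)) in *.
      replace (dist_Z (x * d) / d - dist_Z (y * d) / d)
        with ((dist_Z (x * d) - dist_Z (y * d)) * / d) by (unfold Rdiv; ring).
      rewrite Rabs_mult, (Rabs_right (/ d)) by (apply Rle_ge; left; now apply Rinv_0_lt_compat).
      apply (Rmult_le_reg_r d); [lra|]. rewrite Rmult_assoc, Rinv_l, Rmult_1_r by lra.
      eapply Rle_trans; [apply dist_Z_lipschitz|].
      replace (x * d - y * d) with (- ((y - x) * d)) by ring.
      rewrite Rabs_Ropp, Rabs_right; [lra|]. apply Rle_ge, Rmult_le_pos; lra.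
    (* Different cells: the ends [/ INR n] and [/ (INR m + 1)] lie between [x] and [y], and each
       value is at most the distance to the nearer of these ends. *)
    + assert (INR (m + 1) <= INR n) by (apply le_INR; lia).
      rewrite plus_INR in H. change (INR 1) with 1 in H.
      assert (/ INR n <= / (INR m + 1)) by (apply Rinv_le_contravar; lra).
      pose proof (grid_dist_bounds B n x HB Hn) as [H1 H2].
      pose proof (Rmin_r (x - / (INR n + 1)) (/ INR n - x)).
      pose proof (grid_dist_bounds B m y HB Hm) as [G1 G2].
      pose proof (Rmin_l (y - / (INR m + 1)) (/ INR m - y)).
      unfold Rabs. destruct (Rcase_abs _); lra.
Qed.

Lemma grid_dist_lipschitz B x y : (1 <= B)%nat ->
  Rabs (grid_dist B x - grid_dist B y) <= Rabs (x - y).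
Proof.
  intros HB. destruct (Rtotal_order x y) as [H|[->|H]].
  - eapply Rle_trans; [now apply grid_dist_lipschitz_lt|]. rewrite Rabs_left1; lra.
  - rewrite !Rminus_diag. lra.
  - rewrite Rabs_minus_sym. eapply Rle_trans; [now apply grid_dist_lipschitz_lt|].
    rewrite Rabs_right; lra.
Qed.

Local Close Scope R_scope.

(** * The grid distance on fractions, and its computability *)

Section GridExpr.

Variable B : nat.

Let m : expr :=
  App2 (Times (Times (V 0) (Plus (V 0) (const 1))) (Pow B (V 0))) (Div (V 1) (V 0)) Zero.
Let t : expr := Times (V 0) m.
Let r : expr := Sub t (Times (V 1) (Div t (V 1))).

(** For [x = a / b] in the unit interval, [d] the density and [r] the remainder of [a * d] by [b],
    the fractional part of [x * d] is [r / b], so the distance is [min r (b - r) / (b * d)]. If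
    [d = 0] the numerator is 0, and [Succ (Pred _)] in [grid_den] keeps the denominator positive. *)
Definition grid_num : expr := Min r (Sub (V 1) r).
Definition grid_den : expr := Succ (Pred (Times (V 1) m)).
Definition grid_expr : expr :=
  App2 (Pair (Pair grid_num Zero) grid_den) (Fst (Fst (V 0))) (Snd (V 0)).

Lemma ev_grid_num_den a b : 1 <= B -> b <> 0 ->
  (INR (ev grid_num [a; b]) / INR (ev grid_den [a; b]) = grid_dist B (INR a / INR b))%R.
Proof.
  intros HB Hb. set (d := ev m [a; b]).
  assert (Er : ev r [a; b] = (a * d) mod b).
  { unfold r. rewrite ev_Sub, ev_Times. change (ev (V 1) [a; b]) with b.
    rewrite ev_Div by exact Hb. change (ev (V 1) [a; b]) with b.
    unfold t. rewrite ev_Times. fold d. change (ev (V 0) [a; b]) with a.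
    pose proof (Nat.div_mod_eq (a * d) b). lia. }
  assert (En : ev grid_num [a; b] = min ((a * d) mod b) (b - (a * d) mod b)).
  { unfold grid_num. rewrite ev_Min, ev_Sub, Er. reflexivity. }
  assert (Ed : ev grid_den [a; b] = S (pred (b * d))).
  { unfold grid_den. cbn [ev]. rewrite ev_Pred, ev_Times. reflexivity. }
  rewrite En, Ed.
  (* Serves the cases [a = 0] and [b <= a], in which the fraction lies outside the open unit
     interval. *)
  assert (Hzero : (a * d) mod b = 0 -> grid_dist B (INR a / INR b) = 0%R ->
    (INR (min ((a * d) mod b) (b - (a * d) mod b)) / INR (S (pred (b * d)))
       = grid_dist B (INR a / INR b))%R).
  { intros -> ->. rewrite Nat.min_0_l. change (INR 0) with 0%R. unfold Rdiv. ring. }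
  assert (Hb' : (0 < INR b)%R) by (apply lt_0_INR; lia).
  destruct (Nat.eq_dec a 0) as [->|Ha].
  { apply Hzero; [now rewrite Nat.Div0.mod_0_l|]. apply grid_dist_outside. left.
    change (INR 0) with 0%R. unfold Rdiv. lra. }
  assert (Edn : d = density B (b / a)).
  { unfold d, m. cbn [ev]. rewrite ev_Div by exact Ha. cbn [nth ev].
    rewrite ev_Times, ev_Times, ev_Plus, ev_const, ev_Pow. reflexivity. }
  destruct (le_lt_dec b a) as [Hab|Hab].
  { apply Hzero.
    - destruct (Nat.eq_dec a b) as [->|Hne]; [rewrite Nat.mul_comm; apply Nat.Div0.mod_mul|].
      rewrite Edn, Nat.div_small by lia. unfold density. simpl. rewrite Nat.mul_0_r.
      apply Nat.Div0.mod_0_l.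
    - apply grid_dist_outside. right. apply (Rmult_le_reg_r (INR b)); [exact Hb'|].
      unfold Rdiv. rewrite Rmult_assoc, Rinv_l, Rmult_1_r, Rmult_1_l by lra. now apply le_INR. }
  assert (Ha' : (0 < INR a)%R) by (apply lt_0_INR; lia).
  set (n := b / a) in *.
  assert (Hn : 1 <= n) by (apply Nat.div_le_lower_bound; lia).
  assert (Hcell : in_cell n (INR a / INR b)).
  { split; [exact Hn|].
    pose proof (Nat.div_mod_eq b a). pose proof (Nat.mod_upper_bound b a Ha). fold n in H.
    assert (H1 : (INR b <= (INR n + 1) * INR a)%R).
    { change 1%R with (INR 1). rewrite <- plus_INR, <- mult_INR. apply le_INR. nia. }
    assert (H2 : (INR n * INR a <= INR b)%R).
    { rewrite <- mult_INR. apply le_INR. nia. }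
    apply le_INR in Hn. change (INR 1) with 1%R in Hn. split.
    - apply (Rmult_le_reg_r (INR b * (INR n + 1))); [apply Rmult_lt_0_compat; lra|].
      replace (/ (INR n + 1) * (INR b * (INR n + 1)))%R with (INR b) by (field; lra).
      replace (INR a / INR b * (INR b * (INR n + 1)))%R with ((INR n + 1) * INR a)%R
        by (field; lra). exact H1.
    - apply (Rmult_le_reg_r (INR b * INR n)); [apply Rmult_lt_0_compat; lra|].
      replace (/ INR n * (INR b * INR n))%R with (INR b) by (field; lra).
      replace (INR a / INR b * (INR b * INR n))%R with (INR n * INR a)%R
        by (field; lra). exact H2. }
  rewrite (grid_dist_cell B n _ HB Hcell), <- Edn.
  assert (Hd : (0 < INR d)%R) by (rewrite Edn; now apply density_pos).
  assert (Hd' : d <> 0) by (intros E; rewrite E in Hd; simpl in Hd; lra).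
  replace (S (pred (b * d))) with (b * d) by nia.
  pose proof (Nat.div_mod_eq (a * d) b) as Hdm. pose proof (Nat.mod_upper_bound (a * d) b Hb) as Hlt.
  set (c := a * d / b) in *. set (s := (a * d) mod b) in *.
  assert (E : (INR a / INR b * INR d = INR c + INR s / INR b)%R).
  { apply (Rmult_eq_reg_r (INR b)); [|lra].
    replace (INR a / INR b * INR d * INR b)%R with (INR a * INR d)%R by (field; lra).
    replace ((INR c + INR s / INR b) * INR b)%R with (INR b * INR c + INR s)%R by (field; lra).
    rewrite <- !mult_INR, <- plus_INR. now rewrite Hdm. }
  assert (Hs : (0 <= INR s / INR b <= 1)%R).
  { apply lt_INR in Hlt. pose proof (pos_INR s). split.
    - apply Rmult_le_pos; [lra|]. left. now apply Rinv_0_lt_compat.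
    - apply (Rmult_le_reg_r (INR b)); [lra|]. unfold Rdiv.
      rewrite Rmult_assoc, Rinv_l by lra. lra. }
  rewrite E, (dist_Z_between _ (Z.of_nat c)) by (rewrite <- INR_IZR_INZ; lra).
  rewrite <- INR_IZR_INZ, mult_INR.
  replace (INR c + INR s / INR b - INR c)%R with (INR s / INR b)%R by ring.
  replace (INR c + 1 - (INR c + INR s / INR b))%R with ((INR b - INR s) / INR b)%R by (field; lra).
  assert (E' : INR (Nat.min s (b - s)) = (Rmin (INR s / INR b) ((INR b - INR s) / INR b) * INR b)%R).
  { destruct (le_lt_dec s (b - s)) as [H|H].
    - rewrite Nat.min_l by exact H. apply le_INR in H. rewrite minus_INR in H by lia.
      rewrite Rmin_left; [field; lra|]. apply Rmult_le_compat_r; [|exact H].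
      left. now apply Rinv_0_lt_compat.
    - rewrite Nat.min_r by lia. rewrite minus_INR by lia. apply lt_INR in H.
      rewrite minus_INR in H by lia.
      rewrite Rmin_right; [field; lra|]. apply Rmult_le_compat_r; [|lra].
      left. now apply Rinv_0_lt_compat. }
  rewrite E'. field. lra.
Qed.

End GridExpr.

(** The expression reads only the positive part of the numerator. Negative rationals are thus
    treated as 0, which is harmless because the function vanishes on both. *)
Lemma ev_grid_expr B q i : 1 <= B ->
  exists q', ev (grid_expr B) [code_Q q; i] = code_Q q' /\ Q2R q' = grid_dist B (Q2R q).
Proof.
  intros HB. set (a := Z.to_nat (Qnum q)). set (b := Pos.to_nat (Qden q)).
  exists (Qmake (Z.of_nat (ev (grid_num B) [a; b])) (Pos.of_nat (ev (grid_den B) [a; b]))).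
  assert (Hden : ev (grid_den B) [a; b] <> 0) by (cbn [grid_den ev]; lia).
  assert (Hb : b <> 0) by (unfold b; lia).
  split.
  - unfold grid_expr. cbn [ev].
    assert (E1 : ev (Fst (V 0)) [code_Q q; i] = code_Z (Qnum q)).
    { eapply ev_Fst. reflexivity. }
    assert (E2 : ev (Fst (Fst (V 0))) [code_Q q; i] = a).
    { eapply ev_Fst. rewrite E1. reflexivity. }
    assert (E3 : ev (Snd (V 0)) [code_Q q; i] = b).
    { eapply ev_Snd. reflexivity. }
    rewrite E2, E3, ev_Pair, ev_Pair. unfold code_Q, code_Z. cbn [Qnum Qden].
    rewrite Nat2Z.id, Nat2Pos.id by exact Hden.
    replace (Z.to_nat (- Z.of_nat _)) with 0 by lia. reflexivity.
  - assert (E : Q2R (Qmake (Z.of_nat (ev (grid_num B) [a; b])) (Pos.of_nat (ev (grid_den B) [a; b])))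
        = (INR (ev (grid_num B) [a; b]) / INR (ev (grid_den B) [a; b]))%R).
    { unfold Q2R. cbn [Qnum Qden]. rewrite <- INR_IZR_INZ.
      rewrite <- positive_nat_Z, Nat2Pos.id by exact Hden. now rewrite <- INR_IZR_INZ. }
    rewrite E, (ev_grid_num_den B a b HB Hb).
    destruct (Z_le_gt_dec 0 (Qnum q)) as [H|H].
    + f_equal. unfold Q2R, a, b, Rdiv. rewrite !INR_IZR_INZ, Z2Nat.id, positive_nat_Z by exact H.
      reflexivity.
    + replace a with 0 by (unfold a; lia). rewrite !grid_dist_outside; [reflexivity| |].
      * left. unfold Q2R. assert (IZR (Qnum q) <= 0)%R by (apply IZR_le; lia).
        assert (0 < / IZR (Z.pos (Qden q)))%R by (apply Rinv_0_lt_compat, IZR_lt; lia). nra.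
      * left. change (INR 0) with 0%R. unfold Rdiv. lra.
Qed.

Lemma grid_dist_realizable B : 1 <= B -> exists M, realizes M (grid_dist B).
Proof.
  intros HB. destruct (expr_machine (grid_expr B)) as [M HM]. exists M.
  intros x p Hp.
  pose (r := fun i => proj1_sig (constructive_indefinite_description _ (ev_grid_expr B (p i) i HB))).
  assert (Hr : forall i, ev (grid_expr B) [code_Q (p i); i] = code_Q (r i) /\
                         Q2R (r i) = grid_dist B (Q2R (p i))).
  { intros i. unfold r. now destruct (constructive_indefinite_description _ _). }
  exists r. split.
  - intros i. rewrite (proj2 (Hr i)).
    eapply Rle_lt_trans; [now apply grid_dist_lipschitz|]. apply Hp.
  - intros i. rewrite <- (proj1 (Hr i)). apply HM.
Qed.

(** * Uniqueness of the function computed by a machine *)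

Lemma name_exists x : exists p, is_name p x.
Proof.
  exists (fun i => Qmake (Int_part (x * 2 ^ i)) (Pos.of_nat (2 ^ i))).
  intros i. unfold Q2R. cbn [Qnum Qden].
  rewrite <- (positive_nat_Z (Pos.of_nat (2 ^ i))), Nat2Pos.id by (apply Nat.pow_nonzero; lia).
  rewrite <- INR_IZR_INZ, pow_INR. change (INR 2) with 2%R.
  destruct (base_Int_part (x * 2 ^ i)) as [H1 H2].
  assert (Hp : (0 < 2 ^ i)%R) by (apply pow_lt; lra).
  set (k := IZR (Int_part (x * 2 ^ i))) in *.
  replace (k * / 2 ^ i - x)%R with ((k - x * 2 ^ i) * / 2 ^ i)%R by (field; lra).
  assert (Hi : (0 < / 2 ^ i)%R) by now apply Rinv_0_lt_compat.
  rewrite Rabs_mult, (Rabs_right (/ 2 ^ i)) by lra.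
  rewrite <- (Rmult_1_l (/ 2 ^ i)) at 2. apply Rmult_lt_compat_r; [exact Hi|].
  rewrite Rabs_left1; lra.
Qed.

Lemma is_name_unique p x y : is_name p x -> is_name p y -> x = y.
Proof.
  intros Hx Hy. apply cond_eq. intros eps Heps.
  destruct (pow_lt_1_zero (/ 2) ltac:(rewrite Rabs_right; lra) (eps / 2) ltac:(lra)) as [N HN].
  specialize (HN N (le_n N)). specialize (Hx N). specialize (Hy N).
  rewrite pow_inv in HN. assert (0 < / 2 ^ N)%R by (apply Rinv_0_lt_compat, pow_lt; lra).
  rewrite Rabs_right in HN by lra.
  apply Rabs_def2 in Hx, Hy. apply Rabs_def1; lra.
Qed.

Lemma run_halted O M k c : step O M c = None -> run O M k c = c.
Proof. intros H. destruct k; simpl; [reflexivity|now rewrite H]. Qed.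

Lemma computes_deterministic M O n m m' : computes M O n m -> computes M O n m' -> m = m'.
Proof.
  intros (k & H1 & <-) (k' & H2 & <-).
  assert (E : forall a b, a <= b -> step O M (run O M a (init M n)) = None ->
    run O M b (init M n) = run O M a (init M n)).
  { intros a b Hab H. replace b with (a + (b - a)) by lia. rewrite run_add. now apply run_halted. }
  destruct (le_ge_dec k k') as [H|H].
  - now rewrite (E _ _ H H1).
  - now rewrite (E _ _ H H2).
Qed.

Lemma code_Z_inj z z' : code_Z z = code_Z z' -> z = z'.
Proof. intros H. apply pairn_inj in H as [H1 H2]. lia. Qed.

Lemma code_Q_inj q q' : code_Q q = code_Q q' -> q = q'.
Proof.
  intros H. apply pairn_inj in H as [H1 H2]. apply code_Z_inj in H1.
  apply Pos2Nat.inj in H2. destruct q, q'. simpl in *. congruence.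
Qed.

Lemma realizes_unique M f g : realizes M f -> realizes M g -> f = g.
Proof.
  intros Hf Hg. apply functional_extensionality. intros x.
  destruct (name_exists x) as [p Hp].
  destruct (Hf x p Hp) as (r & Hr & Hc). destruct (Hg x p Hp) as (r' & Hr' & Hc').
  apply (is_name_unique r); [exact Hr|]. intros i. specialize (Hr' i).
  replace (r i) with (r' i); [exact Hr'|].
  apply code_Q_inj. eapply computes_deterministic; eauto.
Qed.

(** [interp] obtains its function by choice; uniqueness is what identifies it with the intended
    one. *)
Lemma grid_symbol B : 1 <= B -> exists s : symbol, interp s = grid_dist B.
Proof.
  intros HB. destruct (grid_dist_realizable B HB) as [M HM].
  exists (exist _ M (ex_intro _ _ HM)). unfold interp.
  destruct (constructive_indefinite_description _ _) as [f Hf]. simpl in *.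
  eapply realizes_unique; eauto.
Qed.

(** * Definability by bounded formulas *)

Definition up (xi : nat -> nat) (i : nat) : nat :=
  match i with 0 => 0 | S j => S (xi j) end.

Fixpoint ren_term (xi : nat -> nat) (t : term) : term :=
  match t with
  | Var i => Var (xi i)
  | Const q => Const q
  | Add s t => Add (ren_term xi s) (ren_term xi t)
  | Mul s t => Mul (ren_term xi s) (ren_term xi t)
  | App h t => App h (ren_term xi t)
  end.

Definition ren_atom (xi : nat -> nat) (a : atom) : atom :=
  match a with
  | Ge s t => Ge (ren_term xi s) (ren_term xi t)
  | Gt s t => Gt (ren_term xi s) (ren_term xi t)
  end.

Definition ren_literal (xi : nat -> nat) (l : literal) : literal :=
  match l with
  | Positive a => Positive (ren_atom xi a)
  | Negated a => Negated (ren_atom xi a)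
  end.

Fixpoint ren (xi : nat -> nat) (phi : bformula) : bformula :=
  match phi with
  | Matrix psi => Matrix (map (map (ren_literal xi)) psi)
  | Quant q a b phi => Quant q (ren_term xi a) (ren_term xi b) (ren (up xi) phi)
  end.

Lemma eval_ren rho xi t : eval rho (ren_term xi t) = eval (fun i => rho (xi i)) t.
Proof. induction t; simpl; congruence. Qed.

Lemma sat_literal_ren rho xi l :
  sat_literal rho (ren_literal xi l) <-> sat_literal (fun i => rho (xi i)) l.
Proof. destruct l as [[s t|s t]|[s t|s t]]; simpl; now rewrite !eval_ren. Qed.

Lemma extend_up y rho xi :
  (fun i => extend y rho (up xi i)) = extend y (fun i => rho (xi i)).
Proof. apply functional_extensionality. now intros [|i]. Qed.

Lemma sat_ren phi : forall rho xi, sat rho (ren xi phi) <-> sat (fun i => rho (xi i)) phi.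
Proof.
  induction phi as [psi|[|] a b phi IH]; intros rho xi; simpl.
  - unfold sat_cnf. rewrite Forall_map.
    induction psi as [|c psi IH]; [split; constructor|].
    rewrite !Forall_cons_iff, IH, Exists_map.
    enough (E : Exists (fun l => sat_literal rho (ren_literal xi l)) c <->
                Exists (sat_literal (fun i => rho (xi i))) c) by tauto.
    rewrite !Exists_exists. split; intros (l & H1 & H2); exists l; split; auto;
      now apply sat_literal_ren.
  - rewrite !eval_ren. split; intros (y & H1 & H2 & H); exists y; repeat split; auto;
      [apply IH in H; now rewrite extend_up in H|apply IH; now rewrite extend_up].
  - rewrite !eval_ren. split; intros H y Hy; specialize (H y Hy);
      [apply IH in H; now rewrite extend_up in H|apply IH; now rewrite extend_up].
Qed.

Lemma term_below_ren n m xi t :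
  (forall i, i < n -> xi i < m) -> term_below n t -> term_below m (ren_term xi t).
Proof. intros H. induction t; simpl; intuition. Qed.

Lemma bformula_below_ren phi : forall n m xi,
  (forall i, i < n -> xi i < m) -> bformula_below n phi -> bformula_below m (ren xi phi).
Proof.
  induction phi as [psi|q a b phi IH]; intros n m xi H; simpl.
  - rewrite Forall_map. apply Forall_impl. intros c. rewrite Forall_map. apply Forall_impl.
    intros [[s t|s t]|[s t|s t]]; simpl; intros [H1 H2]; split; eapply term_below_ren; eauto.
  - intros (H1 & H2 & H3). repeat split; try (eapply term_below_ren; eauto; fail).
    apply (IH (S n)); [|exact H3]. intros [|i] Hi; simpl; [lia|]. apply -> Nat.succ_lt_mono.
    apply H. lia.
Qed.

(** * Definable predicates and their closure under logical operations *)

Fixpoint unit_bounds (phi : bformula) : Prop :=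
  match phi with
  | Matrix _ => True
  | Quant _ a b phi => a = Const 0 /\ b = Const 1 /\ unit_bounds phi
  end.

Lemma unit_bounds_ren phi : forall xi, unit_bounds phi -> unit_bounds (ren xi phi).
Proof. induction phi; intros xi; simpl; [auto|]. intros (-> & -> & H). simpl. auto. Qed.

(** All quantifiers range over [[0, 1]]: for nonempty ranges, quantifiers can be
    moved in front of conjunctions. *)
Definition definable (n : nat) (P : (nat -> R) -> Prop) : Prop :=
  exists phi, unit_bounds phi /\ bformula_below n phi /\ forall rho, sat rho phi <-> P rho.

Definition unit_int (y : R) : Prop := (0 <= y /\ y <= 1)%R.

Lemma D_ext n P Q : (forall rho, P rho <-> Q rho) -> definable n P -> definable n Q.
Proof.
  intros H (phi & H1 & H2 & H3). exists phi. split; [exact H1|]. split; [exact H2|].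
  intros rho. now rewrite H3.
Qed.

Lemma eval_unit_bounds rho : eval rho (Const 0) = 0%R /\ eval rho (Const 1) = 1%R.
Proof. split; cbn [eval]; unfold Q2R; simpl; lra. Qed.

Lemma sat_unit_ex rho phi :
  sat rho (Quant Ex (Const 0) (Const 1) phi) <-> exists y, unit_int y /\ sat (extend y rho) phi.
Proof.
  cbn [sat]. destruct (eval_unit_bounds rho) as [-> ->]. unfold unit_int.
  split; [intros (y & H1 & H2 & H3)|intros (y & (H1 & H2) & H3)]; eauto.
Qed.

Lemma sat_unit_all rho phi :
  sat rho (Quant All (Const 0) (Const 1) phi) <-> forall y, unit_int y -> sat (extend y rho) phi.
Proof.
  cbn [sat]. destruct (eval_unit_bounds rho) as [-> ->]. unfold unit_int. tauto.
Qed.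

(** De Morgan and distribution: the negation of a clause is a conjunction of literals, and its
    disjunction with [psi'] has a clause for each pair of a literal and a clause. The empty
    conjunction is negated by the single empty clause. *)
Lemma cnf_not n psi : Forall (Forall (literal_below n)) psi ->
  exists psi', Forall (Forall (literal_below n)) psi' /\
    forall rho, sat_cnf rho psi' <-> ~ sat_cnf rho psi.
Proof.
  pose (neg := fun l => match l with Positive a => Negated a | Negated a => Positive a end).
  assert (Hneg : forall rho l, sat_literal rho (neg l) <-> ~ sat_literal rho l).
  { intros rho [a|a]; simpl; [tauto|]. split; [tauto|]. apply NNPP. }
  induction 1 as [|c psi Hc _ (psi' & H1 & H2)].
  - exists [[]]. split; [repeat constructor|]. intros rho. unfold sat_cnf. split.
    + intros H. inversion H as [|? ? H0]. inversion H0.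
    + intros H. destruct H. constructor.
  - exists (flat_map (fun l => map (cons (neg l)) psi') c). split.
    + apply Forall_forall. intros d Hd. apply in_flat_map in Hd as (l & Hl & Hd).
      apply in_map_iff in Hd as (d' & <- & Hd'). rewrite Forall_forall in H1, Hc. constructor.
      * specialize (Hc l Hl). destruct l; exact Hc.
      * now apply H1.
    + intros rho. unfold sat_cnf in *. rewrite Forall_cons_iff.
      assert (E : Forall (Exists (sat_literal rho)) (flat_map (fun l => map (cons (neg l)) psi') c)
        <-> forall l, In l c -> ~ sat_literal rho l \/ Forall (Exists (sat_literal rho)) psi').
      { rewrite Forall_forall. split.
        - intros H l Hl. destruct (classic (sat_literal rho l)) as [Hs|Hs]; [right|now left].
          apply Forall_forall. intros d Hd.
          assert (Hd' : Exists (sat_literal rho) (neg l :: d)).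
          { apply H, in_flat_map. exists l. split; [exact Hl|now apply in_map]. }
          inversion Hd'; subst; [apply Hneg in H3; contradiction|assumption].
        - intros H d Hd. apply in_flat_map in Hd as (l & Hl & Hd).
          apply in_map_iff in Hd as (d' & <- & Hd').
          destruct (H l Hl) as [Hs|Hs].
          + apply Exists_cons_hd. now apply Hneg.
          + apply Exists_cons_tl. rewrite Forall_forall in Hs. now apply Hs. }
      rewrite E. setoid_rewrite H2. rewrite Exists_exists. split.
      * intros H [(l & Hl & Hs) H']. destruct (H l Hl); contradiction.
      * intros H l Hl. destruct (classic (sat_literal rho l)); [right|now left].
        intros H'. apply H. split; [eauto|exact H'].
Qed.

Lemma D_not n P : definable n P -> definable n (fun rho => ~ P rho).
Proof.
  intros (phi & Hu & Hb & Hs).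
  apply (D_ext n (fun rho => ~ sat rho phi)); [intros rho; now rewrite Hs|].
  clear Hs P. revert n Hb; induction phi as [psi|q a b phi IH]; intros n Hb.
  - destruct (cnf_not n psi Hb) as (psi' & H1 & H2). exists (Matrix psi'). simpl. auto.
  - simpl in Hu, Hb. destruct Hu as (-> & -> & Hu). destruct Hb as (_ & _ & Hb).
    destruct (IH Hu (S n) Hb) as (psi & H1 & H2 & H3).
    destruct q.
    + exists (Quant All (Const 0) (Const 1) psi). split; [simpl; auto|]. split; [simpl; auto|].
      intros rho. rewrite sat_unit_ex, sat_unit_all. split.
      * intros H (y & H4 & H5). apply (H3 (extend y rho)); auto.
      * intros H y Hy. apply H3. eauto.
    + exists (Quant Ex (Const 0) (Const 1) psi). split; [simpl; auto|]. split; [simpl; auto|].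
      intros rho. rewrite sat_unit_ex, sat_unit_all. split.
      * intros (y & H4 & H5) H. apply H3 in H5. auto.
      * intros H. apply not_all_ex_not in H as [y H]. apply imply_to_and in H as [H4 H5].
        exists y. split; [exact H4|]. now apply H3.
Qed.

Lemma D_ren n m xi P : definable n P -> (forall i, i < n -> xi i < m) ->
  definable m (fun rho => P (fun i => rho (xi i))).
Proof.
  intros (phi & Hu & Hb & Hs) H. exists (ren xi phi). repeat split.
  - now apply unit_bounds_ren.
  - eapply bformula_below_ren; eauto.
  - intros H'. apply Hs. now apply sat_ren.
  - intros H'. apply sat_ren. now apply Hs.
Qed.

Lemma D_quant q n P : definable (S n) P ->
  definable n (fun rho => match q with
    | Ex => exists y, unit_int y /\ P (extend y rho)
    | All => forall y, unit_int y -> P (extend y rho) end).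
Proof.
  intros (phi & Hu & Hb & Hs). exists (Quant q (Const 0) (Const 1) phi).
  split; [simpl; auto|]. split; [simpl; auto|]. intros rho. destruct q.
  - rewrite sat_unit_ex. split; intros (y & H1 & H2); exists y; split; auto; now apply Hs.
  - rewrite sat_unit_all. split; intros H y Hy; apply Hs; auto.
Qed.

(** Prenexing by two nested inductions: the quantifiers of the left formula are pulled out, with [Q]
    shifted below them; then those of the right formula, against a quantifier-free left side. *)
Lemma D_and n P Q : definable n P -> definable n Q -> definable n (fun rho => P rho /\ Q rho).
Proof.
  assert (H01 : unit_int 0) by (unfold unit_int; lra).
  intros (phi & Hu & Hb & Hs) HQ.
  apply (D_ext n (fun rho => sat rho phi /\ Q rho)); [intros rho; now rewrite Hs|].
  clear Hs P. revert n Q Hb HQ; induction phi as [psi|q a b phi IH]; intros n Q Hb HQ.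
  - destruct HQ as (phi & Hu' & Hb' & Hs).
    apply (D_ext n (fun rho => sat_cnf rho psi /\ sat rho phi)); [intros rho; simpl; now rewrite Hs|].
    clear Q Hu Hs. revert n psi Hb Hb'; induction phi as [psi'|q a b phi IH]; intros n psi Hb Hb'.
    + exists (Matrix (psi ++ psi')). split; [simpl; auto|]. split.
      * simpl. apply Forall_app. split; assumption.
      * intros rho. simpl. unfold sat_cnf. now rewrite Forall_app.
    + simpl in Hu', Hb'. destruct Hu' as (-> & -> & Hu'). destruct Hb' as (_ & _ & Hb').
      assert (D : definable (S n) (fun rho => sat_cnf rho (map (map (ren_literal S)) psi) /\ sat rho phi)).
      { apply IH; auto. change (bformula_below (S n) (ren S (Matrix psi))).
        eapply bformula_below_ren; [|exact Hb]. intros; lia. }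
      assert (E : forall y rho, sat_cnf (extend y rho) (map (map (ren_literal S)) psi) <-> sat_cnf rho psi).
      { intros y rho. apply (sat_ren (Matrix psi) (extend y rho) S). }
      apply (D_quant q) in D. eapply D_ext; [|exact D].
      intros rho. destruct q; cbv beta.
      * rewrite sat_unit_ex. setoid_rewrite E. split.
        -- intros (y & Hy & H1 & H2). eauto.
        -- intros [H1 (y & Hy & H2)]. eauto.
      * rewrite sat_unit_all. setoid_rewrite E. split.
        (* Over an empty range the universal quantifier would lose the first conjunct; the point 0
           recovers it. *)
        -- intros H. split; [apply (H 0%R H01)|intros y Hy; now apply H].
        -- intros [H1 H2] y Hy. auto.
  - simpl in Hu, Hb. destruct Hu as (-> & -> & Hu). destruct Hb as (_ & _ & Hb).
    assert (D : definable (S n) (fun rho => sat rho phi /\ Q (fun i => rho (S i)))).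
    { apply (IH Hu (S n) (fun rho => Q (fun i => rho (S i)))); [exact Hb|].
      apply (D_ren n); [exact HQ|]. intros; lia. }
    apply (D_quant q) in D. eapply D_ext; [|exact D].
    assert (E : forall y rho, Q (fun i => extend y rho (S i)) <-> Q rho) by (intros; reflexivity).
    intros rho. destruct q; cbv beta.
    + rewrite sat_unit_ex. setoid_rewrite E. split.
      * intros (y & Hy & H1 & H2). eauto.
      * intros [(y & Hy & H1) H2]. eauto.
    + rewrite sat_unit_all. setoid_rewrite E. split.
      * intros H. split; [intros y Hy; now apply H|apply (H 0%R H01)].
      * intros [H1 H2] y Hy. auto.
Qed.

Definition rest (rho : nat -> R) : nat -> R := fun i => rho (S i).

Lemma D_ex n (P : R -> (nat -> R) -> Prop) :
  definable (S n) (fun rho => P (rho 0) (rest rho)) ->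
  definable n (fun rho => exists y, unit_int y /\ P y rho).
Proof. exact (D_quant Ex n _). Qed.

Lemma D_all n (P : R -> (nat -> R) -> Prop) :
  definable (S n) (fun rho => P (rho 0) (rest rho)) ->
  definable n (fun rho => forall y, unit_int y -> P y rho).
Proof. exact (D_quant All n _). Qed.

Lemma D_or n P Q : definable n P -> definable n Q -> definable n (fun rho => P rho \/ Q rho).
Proof.
  intros HP HQ. apply (D_ext n (fun rho => ~ (~ P rho /\ ~ Q rho))).
  - intros rho. destruct (classic (P rho)), (classic (Q rho)); tauto.
  - apply D_not, D_and; now apply D_not.
Qed.

Lemma D_imp n P Q : definable n P -> definable n Q -> definable n (fun rho => P rho -> Q rho).
Proof.
  intros HP HQ. apply (D_ext n (fun rho => ~ P rho \/ Q rho)).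
  - intros rho. destruct (classic (P rho)); tauto.
  - apply D_or; [now apply D_not|exact HQ].
Qed.

Lemma D_iff n P Q : definable n P -> definable n Q -> definable n (fun rho => P rho <-> Q rho).
Proof. intros HP HQ. apply D_and; now apply D_imp. Qed.

Lemma D_ge n s t : term_below n s -> term_below n t ->
  definable n (fun rho => eval rho s >= eval rho t)%R.
Proof.
  intros Hs Ht. exists (Matrix [[Positive (Ge s t)]]). split; [simpl; auto|]. split.
  - simpl. repeat constructor; assumption.
  - intros rho. simpl. unfold sat_cnf. rewrite Forall_cons_iff, Exists_cons. simpl.
    split; [intros [[H|H] _]; [exact H|inversion H]|intros H; split; [now left|constructor]].
Qed.

Lemma D_gt n s t : term_below n s -> term_below n t ->
  definable n (fun rho => eval rho s > eval rho t)%R.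
Proof.
  intros Hs Ht. apply (D_ext n (fun rho => ~ (eval rho t >= eval rho s)%R)).
  - intros rho. split; intros H; lra.
  - now apply D_not, D_ge.
Qed.

Lemma D_eq_term n s t : term_below n s -> term_below n t ->
  definable n (fun rho => eval rho s = eval rho t).
Proof.
  intros Hs Ht. apply (D_ext n (fun rho => (eval rho s >= eval rho t) /\ (eval rho t >= eval rho s))%R).
  - intros rho. split; intros H; lra.
  - apply D_and; now apply D_ge.
Qed.

(** * Numbers and sets of numbers as reals in [[0, 1]] *)

Definition ncode (n : nat) : R := (/ (INR n + 1))%R.

Definition is_ncode (x : R) : Prop := exists n, x = ncode n.

(** Junk value 0 outside the range of [ncode]. *)
Definition nval (x : R) : nat :=
  match excluded_middle_informative (is_ncode x) with
  | left H => proj1_sig (constructive_indefinite_description _ H)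
  | right _ => 0
  end.

Lemma ncode_bounds n : (0 < ncode n <= 1)%R.
Proof.
  unfold ncode. pose proof (pos_INR n). split; [apply Rinv_0_lt_compat; lra|].
  rewrite <- Rinv_1. apply Rinv_le_contravar; lra.
Qed.

Lemma ncode_unit n : unit_int (ncode n).
Proof. pose proof (ncode_bounds n). unfold unit_int. lra. Qed.

Lemma ncode_inj n m : ncode n = ncode m -> n = m.
Proof.
  unfold ncode. intros H. pose proof (pos_INR n). pose proof (pos_INR m).
  apply (f_equal Rinv) in H. rewrite !Rinv_inv in H. apply INR_eq. lra.
Qed.

Lemma nval_ncode n : nval (ncode n) = n.
Proof.
  unfold nval. destruct (excluded_middle_informative _) as [H|H].
  - destruct (constructive_indefinite_description _ H) as [m Hm]. simpl. now apply ncode_inj.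
  - exfalso. apply H. now exists n.
Qed.

(** The junk value 0 has code 1. This reduces the graph of [nval] to [is_ncode] and equations. *)
Lemma ncode_nval x u : u = ncode (nval x) <-> (is_ncode x /\ u = x) \/ (~ is_ncode x /\ u = 1%R).
Proof.
  unfold nval. destruct (excluded_middle_informative _) as [H|H].
  - destruct (constructive_indefinite_description _ H) as [m Hm]. simpl. subst x. tauto.
  - unfold ncode. simpl. rewrite Rplus_0_l, Rinv_1. tauto.
Qed.

(** For [B = 1] a cell is a single mesh, so the function vanishes on it only at the ends, which are
    codes. The bounds on [x] discard the zeros outside the cells. *)
Lemma is_ncode_grid x : is_ncode x <-> (x > 0 /\ 1 >= x /\ 0 >= grid_dist 1 x)%R.
Proof.
  split.
  - intros [n ->]. pose proof (ncode_bounds n). split; [lra|]. split; [lra|].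
    assert (Hc : in_cell (n + 1) (ncode n)).
    { unfold ncode, in_cell. rewrite plus_INR. change (INR 1) with 1%R. pose proof (pos_INR n).
      split; [lia|]. split; [apply Rinv_le_contravar; lra|lra]. }
    pose proof (grid_dist_bounds 1 _ _ (le_n 1) Hc) as [_ H1].
    pose proof (Rmin_r (ncode n - / (INR (n + 1) + 1)) (/ INR (n + 1) - ncode n)).
    unfold ncode in *. rewrite plus_INR in *. change (INR 1) with 1%R in *. lra.
  - intros (H1 & H2 & H3). destruct (Req_dec x 1) as [->|Hx].
    { exists 0. unfold ncode. simpl. rewrite Rplus_0_l, Rinv_1. reflexivity. }
    destruct (in_cell_ex x ltac:(lra)) as (n & Hc & _).
    rewrite (grid_dist_cell 1 n x (le_n 1) Hc) in H3.
    destruct Hc as [Hn Hc]. pose proof (density_pos 1 n (le_n 1) Hn) as Hm.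
    destruct (cell_ends 1 n Hn) as [E1 E2].
    set (d := INR (density 1 n)) in *. rewrite Nat.pow_1_l in E1, E2. rewrite Nat.mul_1_r in E1, E2.
    assert (H0 : dist_Z (x * d) = 0%R).
    { pose proof (dist_Z_pos (x * d)). apply Rle_antisym; [|lra].
      apply (Rmult_le_reg_r (/ d)); [now apply Rinv_0_lt_compat|]. unfold Rdiv in H3. lra. }
    destruct (dist_Z_attained (x * d)) as [k Hk]. rewrite H0 in Hk. symmetry in Hk.
    assert (E : (x * d = IZR k)%R).
    { destruct (Req_dec (x * d - IZR k) 0) as [|Hne]; [lra|]. now apply Rabs_no_R0 in Hne. }
    assert (L1 : (Z.of_nat n <= k)%Z).
    { apply le_IZR. rewrite <- E, <- E1. apply Rmult_le_compat_r; lra. }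
    assert (L2 : (k <= Z.of_nat (n + 1))%Z).
    { apply le_IZR. rewrite <- E, <- E2. apply Rmult_le_compat_r; lra. }
    assert (Hk' : k = Z.of_nat n \/ k = Z.of_nat (n + 1)) by lia.
    destruct Hk' as [-> | ->].
    + exists n. unfold ncode. apply (Rmult_eq_reg_r d); lra.
    + exists (n - 1). unfold ncode. rewrite minus_INR by lia. change (INR 1) with 1%R.
      replace (INR n - 1 + 1)%R with (INR n) by ring. apply (Rmult_eq_reg_r d); lra.
Qed.

(** The set [X] is coded by the sum [x] of [4^-(n+2)] over [n] in [X]: the fractional
    part of [4^(n+1) x] lies in [[1/4, 1/3]] if [n] is in [X] and in [[0, 1/12]] otherwise. *)
Definition sval (x : R) (n : nat) : Prop :=
  unit_int x /\ (dist_Z (x * 4 ^ S n) >= / 4)%R.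

(** The points [v + x' (ncode n - v)] form the cell with left end [v = ncode (n + 1)].
    No term gives the mesh there, but it is twice the maximum of [grid_dist 4]. *)
Lemma sval_grid x n : sval x n <-> unit_int x /\ exists v, unit_int v /\
  (v * (1 + ncode n) = ncode n)%R /\
  forall x', unit_int x' ->
    (2 * grid_dist 4 (v + x * (ncode n - v)) >= grid_dist 4 (v + x' * (ncode n - v)))%R.
Proof.
  assert (Hn : (0 <= INR n)%R) by apply pos_INR.
  set (N := S n). set (v0 := (/ (INR N + 1))%R).
  assert (EN : INR N = (INR n + 1)%R) by apply S_INR.
  assert (Eu : ncode n = (/ INR N)%R) by (unfold ncode; now rewrite EN).
  assert (Ev : (v0 * (1 + ncode n) = ncode n)%R) by (rewrite Eu; unfold v0; field; lra).
  assert (Hv : forall v, (v * (1 + ncode n) = ncode n)%R -> v = v0).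
  { intros v H. pose proof (ncode_bounds n). apply (Rmult_eq_reg_r (1 + ncode n)); lra. }
  assert (HN : 1 <= N) by (unfold N; lia).
  pose proof (density_pos 4 N ltac:(lia) HN) as Hm.
  (* The affine map of [0, 1] onto cell [N] stretches [4 ^ N] steps of length [/ 4 ^ N] to as many
     meshes, and the left end is a grid point, so periodicity of [dist_Z] removes it. *)
  assert (Hpt : forall y, unit_int y ->
    (grid_dist 4 (v0 + y * (ncode n - v0)) = dist_Z (y * 4 ^ N) / INR (density 4 N))%R).
  { intros y [Hy1 Hy2].
    assert (Hvu : (v0 <= ncode n)%R) by (rewrite Eu; apply Rinv_le_contravar; lra).
    assert (Hc : in_cell N (v0 + y * (ncode n - v0))).
    { split; [exact HN|]. fold v0. rewrite <- Eu. split; nra. }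
    rewrite (grid_dist_cell 4 N _ ltac:(lia) Hc). f_equal.
    destruct (cell_ends 4 N HN) as [E1 _]. fold v0 in E1.
    rewrite Rmult_plus_distr_r, E1.
    replace (y * (ncode n - v0) * INR (density 4 N))%R with (y * 4 ^ N)%R.
    - assert (Hper : forall z k, dist_Z (IZR k + z) = dist_Z z).
      { assert (Hle : forall z k, (dist_Z (IZR k + z) <= dist_Z z)%R).
        { intros z k. destruct (dist_Z_attained z) as [j ->].
          eapply Rle_trans; [apply (dist_Z_le _ (k + j))|]. rewrite plus_IZR.
          right. f_equal. ring. }
        intros z k. apply Rle_antisym; [apply Hle|].
        replace z with (IZR (- k) + (IZR k + z))%R at 1; [apply Hle|].
        rewrite opp_IZR. ring. }
      apply Hper.
    - rewrite INR_density, pow_INR, Eu. unfold v0. replace (INR 4) with 4%R by (simpl; lra).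
      field. lra. }
  assert (Hcmp : forall y z, (2 * (y / INR (density 4 N)) >= z / INR (density 4 N) <-> 2 * y >= z)%R).
  { intros y z. split; intros H.
    - apply (Rmult_ge_compat_r (INR (density 4 N))) in H; [|lra].
      replace (2 * (y / INR (density 4 N)) * INR (density 4 N))%R with (2 * y)%R in H by (field; lra).
      replace (z / INR (density 4 N) * INR (density 4 N))%R with z in H by (field; lra). exact H.
    - apply Rle_ge, (Rmult_le_reg_r (INR (density 4 N))); [lra|].
      replace (2 * (y / INR (density 4 N)) * INR (density 4 N))%R with (2 * y)%R by (field; lra).
      replace (z / INR (density 4 N) * INR (density 4 N))%R with z by (field; lra). lra. }
  unfold sval. fold N. split; intros [Hx H]; (split; [exact Hx|]).
  - exists v0. split; [|split; [exact Ev|]].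
    + unfold unit_int, v0. rewrite EN. split; [left; apply Rinv_0_lt_compat; lra|].
      rewrite <- Rinv_1. apply Rinv_le_contravar; lra.
    + intros x' Hx'. rewrite !Hpt by assumption. apply (proj2 (Hcmp _ _)).
      pose proof (dist_Z_half (x' * 4 ^ N)). lra.
  - destruct H as (v & _ & E & H). apply Hv in E. subst v.
    assert (H4 : (1 <= 4 ^ N)%R) by (apply pow_R1_Rle; lra).
    (* Half a mesh above the left end, where [dist_Z] has its maximum [/ 2]; comparison with twice
       the value at [x] gives the threshold [/ 4]. *)
    assert (Hx' : unit_int (/ 2 * / 4 ^ N)).
    { assert (0 < / 4 ^ N <= 1)%R; [|unfold unit_int; lra].
      split; [apply Rinv_0_lt_compat; lra|]. rewrite <- Rinv_1. apply Rinv_le_contravar; lra. }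
    specialize (H _ Hx'). rewrite !Hpt in H by assumption. apply (proj1 (Hcmp _ _)) in H.
    replace (/ 2 * / 4 ^ N * 4 ^ N)%R with (/ 2)%R in H by (field; lra).
    rewrite (dist_Z_between (/ 2) 0) in H by lra. rewrite Rmin_left in H by lra. lra.
Qed.

(** * Every set of numbers has a code *)

Section SetCode.

Variable X : nat -> Prop.

Fixpoint partial (n : nat) : R :=
  match n with
  | 0 => 0
  | S n => partial n + INR (char_fun X n) * / 4 ^ (S (S n))
  end%R.

Lemma char_fun_01 n : INR (char_fun X n) = 0%R \/ INR (char_fun X n) = 1%R.
Proof. unfold char_fun. destruct (excluded_middle_informative _); auto. Qed.

Lemma pow4_S n : (/ 4 ^ n = 4 * / 4 ^ (S n) /\ 0 < / 4 ^ S n)%R.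
Proof.
  assert (0 < 4 ^ n)%R by (apply pow_lt; lra). split; [simpl; field; lra|].
  apply Rinv_0_lt_compat. simpl. lra.
Qed.

Lemma partial_growing n k : (partial n <= partial (n + k))%R.
Proof.
  induction k as [|k IH]; [rewrite Nat.add_0_r; lra|]. rewrite Nat.add_succ_r.
  cbn [partial]. destruct (pow4_S (S (n + k))) as [_ H]. destruct (char_fun_01 (n + k)) as [E0|E0]; rewrite E0; lra.
Qed.

(** The sum of [4^-(i+2)] over [i >= n] is [4^-(n+1) / 3]. *)
Lemma partial_bound n k :
  (3 * partial (n + k) + / 4 ^ S (n + k) <= 3 * partial n + / 4 ^ S n)%R.
Proof.
  induction k as [|k IH]; [rewrite Nat.add_0_r; lra|]. rewrite Nat.add_succ_r.
  cbn [partial]. destruct (pow4_S (S (n + k))) as [E H]. destruct (char_fun_01 (n + k)) as [E0|E0]; rewrite E0; lra.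
Qed.

Lemma partial_le n m : (3 * partial m <= 3 * partial n + / 4 ^ S n)%R.
Proof.
  destruct (pow4_S m) as [_ Hm]. destruct (pow4_S n) as [_ Hn]. destruct (le_ge_dec n m) as [H|H].
  - pose proof (partial_bound n (m - n)). replace (n + (m - n)) with m in H0 by lia. lra.
  - pose proof (partial_growing m (n - m)). replace (m + (n - m)) with n in H0 by lia. lra.
Qed.

(** The summands with [i < n] become integers after scaling by [4 ^ (n + 1)], so the fractional part
    shows only the digit of [n] and the tail behind it. *)
Lemma partial_integer n : exists k : Z, (partial n * 4 ^ S n = IZR k)%R.
Proof.
  induction n as [|n [k IH]]; [exists 0%Z; simpl; lra|].
  exists (4 * k + Z.of_nat (char_fun X n))%Z. rewrite plus_IZR, mult_IZR, <- INR_IZR_INZ, <- IH.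
  cbn [partial]. assert (0 < 4 ^ n)%R by (apply pow_lt; lra). simpl pow. field. lra.
Qed.

(** The code is the supremum of the partial sums. Surjectivity is all that is asked of [sval]: every
    other real codes some set as well, so quantifying over [0, 1] is quantifying over sets. *)
Lemma sval_surjective : exists x, unit_int x /\ sval x = X.
Proof.
  destruct (completeness (fun y => exists n, y = partial n)) as [x [Hub Hlub]].
  - exists 1%R. intros y [n ->]. pose proof (partial_le 0 n). simpl in H. lra.
  - exists 0%R. now exists 0.
  - assert (Hlo : forall n, (partial n <= x)%R) by (intros n; apply Hub; now exists n).
    assert (Hhi : forall n, (3 * x <= 3 * partial n + / 4 ^ S n)%R).
    { intros n. assert (x <= partial n + / 4 ^ S n * / 3)%R; [|lra].
      apply Hlub. intros y [m ->]. pose proof (partial_le n m). lra. }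
    assert (Hx : unit_int x).
    { split; [apply (Hlo 0)|]. pose proof (Hhi 0). simpl in H. lra. }
    exists x. split; [exact Hx|]. apply functional_extensionality. intros n.
    apply propositional_extensionality.
    assert (Hp : (0 < 4 ^ S n)%R) by (apply pow_lt; lra).
    destruct (partial_integer n) as [k Hk].
    pose proof (Hlo (S n)) as L. pose proof (Hhi (S n)) as U. cbn [partial] in L, U.
    destruct (pow4_S (S n)) as [E Hpos]. destruct (pow4_S (S (S n))) as [E' Hpos'].
    set (c := INR (char_fun X n)) in *.
    set (z := (x * 4 ^ S n)%R).
    assert (E4 : (/ 4 ^ S n * 4 ^ S n = 1)%R) by (field; lra).
    assert (L1 : (IZR k + c / 4 <= z)%R).
    { unfold z. rewrite <- Hk. apply (Rmult_le_compat_r (4 ^ S n)) in L; [|lra].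
      replace (/ 4 ^ S (S n))%R with (/ 4 ^ S n / 4)%R in L by lra.
      replace ((partial n + c * (/ 4 ^ S n / 4)) * 4 ^ S n)%R
        with (partial n * 4 ^ S n + c / 4 * (/ 4 ^ S n * 4 ^ S n))%R in L by (field; lra).
      rewrite E4 in L. lra. }
    assert (U1 : (z <= IZR k + c / 4 + / 12)%R).
    { unfold z. rewrite <- Hk. apply (Rmult_le_compat_r (4 ^ S n)) in U; [|lra].
      replace (/ 4 ^ S (S n))%R with (/ 4 ^ S n / 4)%R in U by lra.
      replace ((3 * (partial n + c * (/ 4 ^ S n / 4)) + / 4 ^ S n / 4) * 4 ^ S n)%R
        with (3 * (partial n * 4 ^ S n) + (3 * c / 4 + / 4) * (/ 4 ^ S n * 4 ^ S n))%R in U by (field; lra).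
      rewrite E4 in U. lra. }
    unfold sval. fold z. unfold c, char_fun in *.
    destruct (excluded_middle_informative (X n)) as [HX|HX]; simpl INR in *.
    + split; [tauto|]. intros _. split; [exact Hx|].
      rewrite (dist_Z_between z k) by lra. apply Rle_ge, Rmin_glb; lra.
    + split; [|tauto]. intros [_ H]. exfalso.
      rewrite (dist_Z_between z k) in H by lra. rewrite Rmin_left in H by lra. lra.
Qed.

End SetCode.

(** * Definability in second-order arithmetic *)

(** Number-valued functions enter through their graphs, with the value as variable 0; nested ones
    are unravelled by [D_inst], which names the inner value. *)
Definition definable_nat (n : nat) (t : (nat -> R) -> nat) : Prop :=
  definable (S n) (fun rho => nval (rho 0) = t (rest rho)).

Lemma D_is_ncode n i : i < n -> definable n (fun rho => is_ncode (rho i)).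
Proof.
  intros Hi. destruct (grid_symbol 1 (le_n 1)) as [f Hf].
  apply (D_ext n (fun rho => eval rho (Var i) > eval rho (Const 0) /\
    eval rho (Const 1) >= eval rho (Var i) /\
    eval rho (Const 0) >= eval rho (App f (Var i)))%R).
  - intros rho. destruct (eval_unit_bounds rho) as [-> ->]. cbn [eval]. rewrite Hf, is_ncode_grid.
    tauto.
  - apply D_and; [|apply D_and]; [apply D_gt|apply D_ge..]; simpl; auto.
Qed.

Lemma D_ncode_nval n i j : i < n -> j < n -> definable n (fun rho => rho i = ncode (nval (rho j))).
Proof.
  intros Hi Hj. eapply D_ext; [intros rho; symmetry; apply ncode_nval|].
  apply D_or; apply D_and.
  - now apply D_is_ncode.
  - now apply (D_eq_term n (Var i) (Var j)).
  - now apply D_not, D_is_ncode.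
  - eapply D_ext; [|apply (D_eq_term n (Var i) (Const 1)); simpl; auto].
    intros rho. destruct (eval_unit_bounds rho) as [_ ->]. simpl. tauto.
Qed.

(** A real variable need not be a code. A fresh variable holds the code of its value, so that [P]
    can be an algebraic condition on genuine codes. *)
Lemma D_code n i (P : R -> (nat -> R) -> Prop) : i < n ->
  definable (S n) (fun rho => P (rho 0) (rest rho)) ->
  definable n (fun rho => P (ncode (nval (rho i))) rho).
Proof.
  intros Hi HP.
  apply (D_ext n (fun rho => exists u, unit_int u /\ u = ncode (nval (rho i)) /\ P u rho)).
  - intros rho. split.
    + intros (u & _ & -> & H). exact H.
    + intros H. exists (ncode (nval (rho i))). split; [apply ncode_unit|auto].
  - apply D_ex. apply D_and; [|exact HP]. apply (D_ncode_nval (S n) 0 (S i)); lia.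
Qed.

Lemma pairn_polynomial a b c :
  c = pairn a b <-> (2 * INR c = 2 * INR b + (INR b + INR a) * (INR b + INR a + 1))%R.
Proof.
  replace (2 * INR b + (INR b + INR a) * (INR b + INR a + 1))%R
    with (INR (2 * b + (b + a) * (b + a + 1))).
  - replace (2 * INR c)%R with (INR (2 * c)) by (rewrite mult_INR; simpl; lra).
    pose proof (Cantor.to_nat_spec a b) as H. fold (pairn a b) in H. split; intros H'.
    + f_equal. lia.
    + apply INR_eq in H'. lia.
  - rewrite !plus_INR, !mult_INR, !plus_INR. simpl. lra.
Qed.

Lemma D_pair_var n i j k : i < n -> j < n -> k < n ->
  definable n (fun rho => nval (rho i) = pairn (nval (rho j)) (nval (rho k))).
Proof.
  intros Hi Hj Hk.
  (* In terms of the codes w, u, v of c, a, b the equation 2c = 2b + (b + a)(b + a + 1)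
     becomes s = t after multiplication by w u^2 v^2. *)
  set (uv := Mul (Var 1) (Var 0)).
  set (s := Add (Mul (Const 2) (Mul uv uv)) (Mul (Const (-2)) (Mul (Mul uv uv) (Var 2)))).
  set (t := Mul (Var 2)
          (Add (Add (Mul (Const 2) (Mul (Var 1) uv)) (Mul (Const (-2)) (Mul uv uv)))
               (Mul (Add (Add (Var 1) (Var 0)) (Mul (Const (-2)) uv))
                    (Add (Add (Var 1) (Var 0)) (Mul (Const (-1)) uv))))).
  pose (poly := fun w u v : R => let rho := extend v (extend u (extend w (fun _ => 0%R))) in
    eval rho s = eval rho t).
  apply (D_ext n (fun rho => poly (ncode (nval (rho i))) (ncode (nval (rho j))) (ncode (nval (rho k))))).
  - intros rho. generalize (nval (rho i)) (nval (rho j)) (nval (rho k)). intros c a b.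
    rewrite pairn_polynomial. unfold poly, ncode. cbn [eval s t uv extend].
    replace (Q2R 2) with 2%R by (unfold Q2R; simpl; lra).
    replace (Q2R (-2)) with (-2)%R by (unfold Q2R; simpl; lra).
    replace (Q2R (-1)) with (-1)%R by (unfold Q2R; simpl; lra).
    pose proof (pos_INR a). pose proof (pos_INR b). pose proof (pos_INR c).
    set (A := INR a) in *. set (B := INR b) in *. set (C := INR c) in *.
    match goal with |- (?l = ?r)%R <-> _ =>
      assert (E : (l - r = (2 * C - (2 * B + (B + A) * (B + A + 1)))
        * / ((A + 1) * (A + 1) * (B + 1) * (B + 1) * (C + 1)))%R) by (field; lra)
    end.
    assert (Hd : (/ ((A + 1) * (A + 1) * (B + 1) * (B + 1) * (C + 1)) <> 0)%R).
    { apply Rinv_neq_0_compat. repeat apply Rmult_integral_contrapositive_currified; lra. }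
    split; intros H'.
    + apply Rminus_diag_eq in H'. rewrite E in H'. apply Rmult_integral in H' as [H'|H'];
        [lra|contradiction].
    + apply Rminus_diag_uniq. rewrite E, H'. ring.
  - apply (D_code n i (fun w rho => poly w (ncode (nval (rho j))) (ncode (nval (rho k))))); [exact Hi|].
    apply (D_code (S n) (S j) (fun u rho => poly (rho 0) u (ncode (nval (rho (S k)))))); [lia|].
    apply (D_code (S (S n)) (S (S k)) (fun v rho => poly (rho 1) (rho 0) v)); [lia|].
    apply (D_eq_term _ s t); simpl; repeat split; lia.
Qed.

(** If [u = 1/(a+1)] then [1/(a+2) = u/(1+u)]; the equation is this one cleared of the fraction. *)
Lemma D_succ_var n i j : i < n -> j < n ->
  definable n (fun rho => nval (rho i) = S (nval (rho j))).
Proof.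
  intros Hi Hj. set (s := Mul (Var 1) (Add (Const 1) (Var 0))).
  pose (poly := fun w u : R => let rho := extend u (extend w (fun _ => 0%R)) in
    eval rho s = eval rho (Var 0)).
  apply (D_ext n (fun rho => poly (ncode (nval (rho i))) (ncode (nval (rho j))))).
  - intros rho. generalize (nval (rho i)) (nval (rho j)). intros c a.
    unfold poly, ncode. cbn [eval s extend].
    replace (Q2R 1) with 1%R by (unfold Q2R; simpl; lra).
    pose proof (pos_INR a). pose proof (pos_INR c). split; intros H'.
    + apply INR_eq. rewrite S_INR.
      apply (Rmult_eq_compat_r ((INR a + 1) * (INR c + 1))) in H'.
      field_simplify in H'; lra.
    + subst c. rewrite S_INR. field. lra.
  - apply (D_code n i (fun w rho => poly w (ncode (nval (rho j))))); [exact Hi|].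
    apply (D_code (S n) (S j) (fun u rho => poly (rho 0) u)); [lia|].
    apply (D_eq_term _ s (Var 0)); simpl; repeat split; lia.
Qed.

Lemma D_zero_var n i : i < n -> definable n (fun rho => nval (rho i) = 0).
Proof.
  intros Hi. apply (D_ext n (fun rho => ncode (nval (rho i)) = eval rho (Const 1))).
  - intros rho. destruct (eval_unit_bounds rho) as [_ ->]. split; intros H.
    + apply ncode_inj. rewrite H. unfold ncode. simpl. lra.
    + rewrite H. unfold ncode. simpl. lra.
  - apply (D_code n i (fun w rho => w = eval rho (Const 1))); [exact Hi|].
    apply (D_eq_term _ (Var 0) (Const 1)); simpl; auto; lia.
Qed.

Lemma D_eq_var n i j : i < n -> j < n -> definable n (fun rho => nval (rho i) = nval (rho j)).
Proof.
  intros Hi Hj. apply (D_ext n (fun rho => rho i = ncode (nval (rho j)) \/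
    ncode (nval (rho i)) = ncode (nval (rho j)))).
  - intros rho. split; [|intros ->; now right]. intros [H|H]; [rewrite H; apply nval_ncode|].
    now apply ncode_inj.
  - apply D_or; [now apply D_ncode_nval|].
    apply (D_code n i (fun w rho => w = ncode (nval (rho j)))); [exact Hi|].
    apply (D_ncode_nval (S n) 0 (S j)); lia.
Qed.

Lemma D_mem_var n i j : i < n -> j < n -> definable n (fun rho => sval (rho i) (nval (rho j))).
Proof.
  intros Hi Hj. destruct (grid_symbol 4 ltac:(lia)) as [h Hh].
  eapply D_ext; [intros rho; symmetry; apply sval_grid|].
  apply D_and.
  - apply (D_ext n (fun rho => eval rho (Var i) >= eval rho (Const 0) /\
      eval rho (Const 1) >= eval rho (Var i))%R).
    + intros rho. destruct (eval_unit_bounds rho) as [-> ->]. unfold unit_int. simpl.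
      split; intros [? ?]; lra.
    + apply D_and; apply D_ge; simpl; auto.
  - apply (D_code n j (fun u rho => exists v, unit_int v /\ (v * (1 + u) = u)%R /\
      forall x', unit_int x' ->
      (2 * grid_dist 4 (v + rho i * (u - v)) >= grid_dist 4 (v + x' * (u - v)))%R)); [exact Hj|].
    apply (D_ex _ (fun v rho => (v * (1 + rho 0%nat) = rho 0%nat)%R /\ forall x', unit_int x' ->
      (2 * grid_dist 4 (v + rho (S i) * (rho 0%nat - v)) >= grid_dist 4 (v + x' * (rho 0%nat - v)))%R)).
    apply D_and.
    + apply (D_ext _ (fun rho => eval rho (Mul (Var 0) (Add (Const 1) (Var 1))) = eval rho (Var 1))).
      * intros rho. cbn [eval]. destruct (eval_unit_bounds rho) as [_ E]. cbn [eval] in E.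
        rewrite E. reflexivity.
      * apply D_eq_term; simpl; repeat split; lia.
    + apply (D_all _ (fun x' rho => (2 * grid_dist 4 (rho 0%nat + rho (S (S i)) * (rho 1%nat - rho 0%nat))
        >= grid_dist 4 (rho 0%nat + x' * (rho 1%nat - rho 0%nat)))%R)).
      (* Variables 0, 1 and 2 are now [x'], [v] and the code of the number; the code of the set has
         moved up by three. *)
      set (pt := fun x => Add (Var 1) (Mul x (Add (Var 2) (Mul (Const (-1)) (Var 1))))).
      apply (D_ext _ (fun rho => (eval rho (Mul (Const 2) (App h (pt (Var (S (S (S i)))))))
        >= eval rho (App h (pt (Var 0))))%R)).
      * intros rho. cbn [eval pt]. rewrite Hh. unfold rest.
        replace (Q2R 2) with 2%R by (unfold Q2R; simpl; lra).
        replace (Q2R (-1)) with (-1)%R by (unfold Q2R; simpl; lra).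
        replace (rho 2%nat + -1 * rho 1%nat)%R with (rho 2%nat - rho 1%nat)%R by ring. reflexivity.
      * apply D_ge; simpl; repeat split; lia.
Qed.

(** [nval] is total and maps [0, 1] onto the numbers, so a real quantifier is a number quantifier
    without relativization to codes. Sets are treated likewise through [sval]. *)
Lemma D_ex_nat n (P : (nat -> R) -> nat -> Prop) :
  definable (S n) (fun rho => P (rest rho) (nval (rho 0))) ->
  definable n (fun rho => exists m, P rho m).
Proof.
  intros H. apply (D_ex n (fun y rho => P rho (nval y))) in H. eapply D_ext; [|exact H].
  intros rho. split.
  - intros (y & _ & Hy). eauto.
  - intros [m Hm]. exists (ncode m). split; [apply ncode_unit|]. now rewrite nval_ncode.
Qed.

Lemma D_all_nat n (P : (nat -> R) -> nat -> Prop) :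
  definable (S n) (fun rho => P (rest rho) (nval (rho 0))) ->
  definable n (fun rho => forall m, P rho m).
Proof.
  intros H. apply (D_all n (fun y rho => P rho (nval y))) in H. eapply D_ext; [|exact H].
  intros rho. split.
  - intros Hy m. rewrite <- (nval_ncode m). apply Hy, ncode_unit.
  - auto.
Qed.

Lemma D_ex_set n (P : (nat -> R) -> (nat -> Prop) -> Prop) :
  definable (S n) (fun rho => P (rest rho) (sval (rho 0))) ->
  definable n (fun rho => exists X, P rho X).
Proof.
  intros H. apply (D_ex n (fun y rho => P rho (sval y))) in H. eapply D_ext; [|exact H].
  intros rho. split.
  - intros (y & _ & Hy). eauto.
  - intros [X HX]. destruct (sval_surjective X) as (x & Hx & <-). eauto.
Qed.

Lemma D_all_set n (P : (nat -> R) -> (nat -> Prop) -> Prop) :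
  definable (S n) (fun rho => P (rest rho) (sval (rho 0))) ->
  definable n (fun rho => forall X, P rho X).
Proof.
  intros H. apply (D_all n (fun y rho => P rho (sval y))) in H. eapply D_ext; [|exact H].
  intros rho. split.
  - intros HX X. destruct (sval_surjective X) as (x & Hx & <-). auto.
  - auto.
Qed.

Lemma DN_rest n t : definable_nat n t -> definable_nat (S n) (fun rho => t (rest rho)).
Proof.
  intros H. apply (D_ren _ (S (S n)) (fun i => match i with 0 => 0 | S i => S (S i) end)) in H;
    [exact H|]. intros [|i]; lia.
Qed.

Lemma DN_var n i : i < n -> definable_nat n (fun rho => nval (rho i)).
Proof. intros Hi. apply (D_eq_var (S n) 0 (S i)); lia. Qed.

Lemma D_inst n t (P : nat -> (nat -> R) -> Prop) : definable_nat n t ->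
  definable (S n) (fun rho => P (nval (rho 0)) (rest rho)) ->
  definable n (fun rho => P (t rho) rho).
Proof.
  intros Ht HP. apply (D_ext n (fun rho => exists m, m = t rho /\ P m rho)).
  - intros rho. split; [intros (m & -> & H); exact H|eauto].
  - apply D_ex_nat. apply D_and; [exact Ht|exact HP].
Qed.

Lemma DN_zero n : definable_nat n (fun _ => 0).
Proof. apply D_zero_var. lia. Qed.

Lemma DN_succ n t : definable_nat n t -> definable_nat n (fun rho => S (t rho)).
Proof.
  intros Ht. apply (D_inst _ _ (fun m rho => nval (rho 0) = S m) (DN_rest _ _ Ht)).
  apply (D_succ_var _ 1 0); lia.
Qed.

Lemma DN_pair n t1 t2 : definable_nat n t1 -> definable_nat n t2 ->
  definable_nat n (fun rho => pairn (t1 rho) (t2 rho)).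
Proof.
  intros H1 H2.
  apply (D_inst _ _ (fun m rho => nval (rho 0) = pairn m (t2 (rest rho))) (DN_rest _ _ H1)).
  apply (D_inst _ _ (fun m rho => nval (rho 1) = pairn (nval (rho 0)) m)
    (DN_rest _ _ (DN_rest _ _ H2))).
  apply (D_pair_var _ 2 1 0); lia.
Qed.

Lemma D_eq n t1 t2 : definable_nat n t1 -> definable_nat n t2 ->
  definable n (fun rho => t1 rho = t2 rho).
Proof. intros H1 H2. exact (D_inst _ _ (fun m rho => m = t2 rho) H1 H2). Qed.

Lemma D_mem n t i : definable_nat n t -> i < n -> definable n (fun rho => sval (rho i) (t rho)).
Proof.
  intros Ht Hi. apply (D_inst _ _ (fun m rho => sval (rho i) m) Ht).
  apply (D_mem_var _ (S i) 0); lia.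
Qed.

(** Relations between several numbers are made unary by pairing; the tactic [define] then manages
    with one rule for defined relations and one for those with a set parameter. *)
Definition definable1 (R : nat -> Prop) : Prop := definable 1 (fun rho => R (nval (rho 0))).

Lemma D_rel1 R n t : definable1 R -> definable_nat n t -> definable n (fun rho => R (t rho)).
Proof.
  intros HR Ht. apply (D_inst _ _ (fun m _ => R m) Ht).
  apply (D_ren _ (S n) (fun i => i)) in HR; [exact HR|]. lia.
Qed.

Definition definable_set1 (R : (nat -> Prop) -> nat -> Prop) : Prop :=
  definable 2 (fun rho => R (sval (rho 1)) (nval (rho 0))).

Lemma D_set_rel1 R n t i : definable_set1 R -> definable_nat n t -> i < n ->
  definable n (fun rho => R (sval (rho i)) (t rho)).
Proof.
  intros HR Ht Hi. apply (D_inst _ _ (fun m rho => R (sval (rho i)) m) Ht).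
  apply (D_ren _ (S n) (fun j => match j with 0 => 0 | _ => S i end)) in HR; [exact HR|].
  intros [|j]; lia.
Qed.

Create HintDb definability.

Ltac define_nat :=
  match goal with
  | |- definable_nat _ (fun _ => 0) => apply DN_zero
  | |- definable_nat _ (fun rho => nval (rho ?i)) => apply DN_var; lia
  | |- definable_nat _ (fun rho => S (@?t rho)) => apply (DN_succ _ t); define_nat
  | |- definable_nat _ (fun rho => pairn (@?s rho) (@?t rho)) => apply (DN_pair _ s t); define_nat
  end.

(** Unfolding [rest] turns outer variables into [rho (S i)], the shape that the patterns of [define]
    recognize. *)
Ltac define_under H := apply H; cbv beta delta [rest].

Ltac define :=
  lazymatch goal with
  | |- definable ?n (fun rho => exists x : nat, @?P rho x) => define_under (D_ex_nat n P); define
  | |- definable ?n (fun rho => exists X : nat -> Prop, @?P rho X) =>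
      define_under (D_ex_set n P); define
  | |- definable ?n (fun rho => forall x : nat, @?P rho x) => define_under (D_all_nat n P); define
  | |- definable ?n (fun rho => forall X : nat -> Prop, @?P rho X) =>
      define_under (D_all_set n P); define
  | |- definable _ (fun rho => _ /\ _) => apply D_and; define
  | |- definable _ (fun rho => _ \/ _) => apply D_or; define
  | |- definable _ (fun rho => ~ _) => apply D_not; define
  | |- definable _ (fun rho => _ <-> _) => apply D_iff; define
  | |- definable _ (fun rho => _ -> _) => apply D_imp; define
  | |- definable ?n (fun rho => @eq nat (@?s rho) (@?t rho)) => apply (D_eq n s t); define_nat
  | |- definable ?n (fun rho => sval (rho ?i) (@?t rho)) => apply (D_mem n t i); [define_nat|lia]
  | |- definable ?n (fun rho => ?R (sval (rho ?i)) (@?t rho)) =>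
      apply (D_set_rel1 R n t i); [solve [auto with definability]|define_nat|lia]
  | |- definable ?n (fun rho => ?R (@?t rho)) =>
      apply (D_rel1 R n t); [solve [auto with definability]|define_nat]
  end.

(** * Turing jumps in second-order arithmetic *)

Local Infix "**" := pairn (at level 35, right associativity).

Local Arguments pairn : simpl never.

Definition code_tape (t : tape) : nat := code_list (tleft t) ** code_list (tright t).
Local Notation code_tapes ts := (code_list (map code_tape ts)).
Definition code_config (c : config) : nat := state c ** code_tapes (tapes c).

Lemma code_list_inj l l' : code_list l = code_list l' -> l = l'.
Proof.
  revert l'; induction l as [|x l IH]; intros [|x' l'] H; simpl in H; try discriminate; auto.
  injection H as H. apply pairn_inj in H as [-> H]. f_equal. auto.
Qed.

Lemma map_inj {A B} (f : A -> B) : (forall x y, f x = f y -> x = y) ->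
  forall l l', map f l = map f l' -> l = l'.
Proof.
  intros Hf. induction l as [|x l IH]; intros [|x' l'] H; simpl in H; try discriminate; auto.
  injection H as H1 H2. f_equal; auto.
Qed.

Lemma code_action_inj a a' : code_action a = code_action a' -> a = a'.
Proof.
  intros H. apply pairn_inj in H as [H1 H]. apply pairn_inj in H as [H2 H3].
  destruct a as [? ? d], a' as [? ? d']. simpl in *. destruct d, d'; simpl in H3; congruence.
Qed.

Lemma code_instruction_inj i i' : code_instruction i = code_instruction i' -> i = i'.
Proof.
  intros H. apply pairn_inj in H as [H1 H]. apply pairn_inj in H as [H2 H3].
  apply code_list_inj in H2. apply map_inj in H2; [|apply code_action_inj].
  destruct i, i'. simpl in *. congruence.
Qed.

Lemma code_machine_inj M M' : code_machine M = code_machine M' -> M = M'.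
Proof.
  intros H. apply pairn_inj in H as [H1 H2]. apply code_list_inj in H2.
  apply map_inj in H2; [|apply code_instruction_inj]. destruct M, M'. simpl in *. congruence.
Qed.

Ltac inj :=
  repeat match goal with
  | H : ?a ** ?b = ?c ** ?d |- _ => apply pairn_inj in H; destruct H
  | H : S _ = S _ |- _ => apply eq_add_S in H
  | H : S _ = 0 |- _ => discriminate H
  | H : 0 = S _ |- _ => discriminate H
  end; subst.

(** The empty list has head 0 and itself as tail, so an exhausted half-tape goes on supplying
    blanks. *)
Definition head_tail (p : nat) : Prop :=
  exists l x r, p = l ** x ** r /\ ((l = 0 /\ x = 0 /\ r = 0) \/ l = S (x ** r)).

Lemma D_head_tail : definable1 head_tail.
Proof. unfold definable1, head_tail. define. Qed.
#[local] Hint Resolve D_head_tail : definability.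

Lemma head_tail_spec l x r :
  head_tail (code_list l ** x ** r) <-> x = hd 0 l /\ r = code_list (tl l).
Proof.
  split.
  - intros (l' & x' & r' & E & H). inj. destruct l as [|y l]; simpl in *.
    + destruct H as [(_ & -> & ->)|H]; [auto|discriminate].
    + destruct H as [(H & _)|H]; [discriminate|]. inj. auto.
  - intros [-> ->]. exists (code_list l), (hd 0 l), (code_list (tl l)). split; [reflexivity|].
    destruct l; simpl; auto.
Qed.

Definition act_rel (p : nat) : Prop :=
  exists x s d l r r' t', p = (x ** s ** d) ** (l ** r) ** t' /\ head_tail (r ** x ** r') /\
    ((d = 0 /\ exists y l', head_tail (l ** y ** l') /\ t' = l' ** S (y ** S (s ** r'))) \/
     (d = 1 /\ t' = S (s ** l) ** r') \/
     (d = 2 /\ t' = l ** S (s ** r'))).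

Lemma D_act_rel : definable1 act_rel.
Proof. unfold definable1, act_rel. define. Qed.
#[local] Hint Resolve D_act_rel : definability.

Lemma act_rel_spec a t t' :
  act_rel (code_action a ** code_tape t ** t') <->
  sym_read a = scanned t /\ t' = code_tape (act a t).
Proof.
  destruct a as [x s d], t as [l r]. unfold code_action, code_tape, act, scanned, write; simpl. split.
  - intros (x' & s' & d' & l0 & r0 & r' & t0 & E & H1 & H2). inj.
    apply head_tail_spec in H1 as [-> ->]. split; [reflexivity|].
    destruct d; simpl in H2 |- *.
    + destruct H2 as [(_ & y & l' & H & ->)|[[H _]|[H _]]]; try discriminate.
      apply head_tail_spec in H as [-> ->]. reflexivity.
    + destruct H2 as [[H _]|[[_ ->]|[H _]]]; try discriminate. reflexivity.
    + destruct H2 as [[H _]|[[H _]|[_ ->]]]; try discriminate. reflexivity.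
  - intros [-> ->].
    exists (hd 0 r), s, (code_move d), (code_list l), (code_list r), (code_list (tl r)). eexists.
    split; [reflexivity|]. split; [now apply head_tail_spec|].
    destruct d; simpl; [left|right; left|right; right]; (split; [reflexivity|]); auto.
    exists (hd 0 l), (code_list (tl l)). split; [now apply head_tail_spec|reflexivity].
Qed.

Definition acts_rel (p : nat) : Prop :=
  forall X : nat -> Prop, X (0 ** 0 ** 0) ->
  (forall a t t' la lt lt', act_rel (a ** t ** t') -> X (la ** lt ** lt') ->
     X (S (a ** la) ** S (t ** lt) ** S (t' ** lt'))) -> X p.

Lemma D_acts_rel : definable1 acts_rel.
Proof. unfold definable1, acts_rel. define. Qed.
#[local] Hint Resolve D_acts_rel : definability.

Definition act_all (l : list action) (ts : list tape) : list tape :=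
  map (fun at_ => act (fst at_) (snd at_)) (combine l ts).

Lemma acts_rel_spec l ts u :
  acts_rel (code_list (map code_action l) ** code_tapes ts ** u) <->
  map sym_read l = map scanned ts /\ u = code_tapes (act_all l ts).
Proof.
  split.
  - intros H.
    (* The intended meaning is itself one of the closed sets [X]. Stated as an implication from the
       shape of [p], it holds vacuously for numbers of any other shape. *)
    refine (H (fun p => forall l ts u, p = code_list (map code_action l) ** code_tapes ts ** u ->
      map sym_read l = map scanned ts /\ u = code_tapes (act_all l ts)) _ _ l ts u eq_refl);
      clear.
    + intros l ts u E. destruct l, ts; simpl in E; inj. auto.
    + intros a t t' la lt lt' Ha IH l ts u E. destruct l as [|a0 l], ts as [|t0 ts]; simpl in E; inj.
      apply act_rel_spec in Ha as [E1 ->].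
      destruct (IH l ts lt' eq_refl) as [E2 ->]. simpl. split; [congruence|reflexivity].
  - intros [H ->] X H0 H1. revert ts H; induction l as [|a l IH]; intros [|t ts] H; simpl in H;
      try discriminate; [exact H0|]. injection H as E1 E2.
    apply (H1 (code_action a) (code_tape t) (code_tape (act a t))); [now apply act_rel_spec|].
    now apply IH.
Qed.

(** [acts_rel] already requires that all scanned symbols agree, so an instruction for the current
    state is applicable if its actions have a result. *)
Definition matches (p : nat) : Prop :=
  exists q ts acts tgt ts', p = (q ** ts) ** (q ** acts ** tgt) /\ acts_rel (acts ** ts ** ts').

Lemma D_matches : definable1 matches.
Proof. unfold definable1, matches. define. Qed.
#[local] Hint Resolve D_matches : definability.

Lemma matches_spec c i :
  matches (code_config c ** code_instruction i) <-> applicable c i = true.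
Proof.
  rewrite applicable_iff. destruct c as [q ts], i as [s l tgt]. unfold code_config, code_instruction; simpl.
  split.
  - intros (q' & ts0 & l0 & tgt' & ts' & E & H). inj. now apply acts_rel_spec in H as [H _].
  - intros [-> H]. repeat eexists. now apply acts_rel_spec.
Qed.

(** Only [matches], defined beforehand, is negated, so the closure conditions stay monotone in
    [X]. *)
Definition find_rel (p : nat) : Prop :=
  exists q ts prog c', p = (q ** ts) ** prog ** c' /\
  forall X : nat -> Prop,
  (forall acts tgt rest ts', acts_rel (acts ** ts ** ts') ->
     X (S ((q ** acts ** tgt) ** rest) ** tgt ** ts')) ->
  (forall i rest c, ~ matches ((q ** ts) ** i) -> X (rest ** c) -> X (S (i ** rest) ** c)) ->
  X (prog ** c').

Lemma D_find_rel : definable1 find_rel.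
Proof. unfold definable1, find_rel. define. Qed.
#[local] Hint Resolve D_find_rel : definability.

Lemma find_rel_spec c prog d :
  find_rel (code_config c ** code_list (map code_instruction prog) ** d) <->
  exists i, find (applicable c) prog = Some i /\
    d = target i ** code_tapes (act_all (actions i) (tapes c)).
Proof.
  split.
  - intros (q & ts & prog' & c' & E & H). unfold code_config in E. inj.
    refine (H (fun p => forall prog d, p = code_list (map code_instruction prog) ** d ->
      exists i, find (applicable c) prog = Some i /\
      d = target i ** code_tapes (act_all (actions i) (tapes c))) _ _ prog c' eq_refl); clear.
    + intros acts tgt rest ts' H prog d E. destruct prog as [|i prog]; simpl in E; inj.
      exists i. unfold code_instruction in H0. inj. apply acts_rel_spec in H as [H ->].
      simpl. rewrite (proj2 (applicable_iff c i)) by auto. auto.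
    + intros i rest c' Hi IH prog d E. destruct prog as [|i' prog]; simpl in E; inj.
      change (state c ** code_tapes (tapes c)) with (code_config c) in Hi.
      rewrite matches_spec in Hi. apply Bool.not_true_is_false in Hi. simpl. rewrite Hi.
      now apply IH.
  - intros (i & Hf & ->). repeat eexists. intros X H1 H2.
    revert Hf. induction prog as [|j prog IH]; simpl; [discriminate|].
    destruct (applicable c j) eqn:E; intros Hf.
    + injection Hf as ->. apply applicable_iff in E as [E1 E2].
      unfold code_instruction. rewrite E1. apply H1. now apply acts_rel_spec.
    + apply H2; [|now apply IH]. fold (code_config c). rewrite matches_spec. congruence.
Qed.

(** [m] is [k] plus the number of strokes in [l]. *)
Definition count_rel (p : nat) : Prop :=
  forall X : nat -> Prop, (forall k, X (0 ** k ** k)) ->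
  (forall x l k m, ~ x = 1 -> X (l ** k ** m) -> X (S (x ** l) ** k ** m)) ->
  (forall x l k m, x = 1 -> X (l ** S k ** m) -> X (S (x ** l) ** k ** m)) -> X p.

Lemma D_count_rel : definable1 count_rel.
Proof. unfold definable1, count_rel. define. Qed.
#[local] Hint Resolve D_count_rel : definability.

Lemma count_rel_spec l k m :
  count_rel (code_list l ** k ** m) <-> m = k + count_occ Nat.eq_dec l 1.
Proof.
  split.
  - intros H.
    refine (H (fun p => forall l k m, p = code_list l ** k ** m ->
      m = k + count_occ Nat.eq_dec l 1) _ _ _ l k m eq_refl); clear.
    + intros k l k' m E. destruct l; simpl in E; inj. simpl. lia.
    + intros x l k m Hx IH l' k' m' E. destruct l' as [|x' l']; simpl in E; inj.
      rewrite count_occ_cons_neq by assumption. now apply IH.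
    + intros x l k m Hx IH l' k' m' E. destruct l' as [|x' l']; simpl in E; inj.
      rewrite count_occ_cons_eq by reflexivity. rewrite (IH l' _ _ eq_refl). lia.
  - intros -> X H0 H1 H2. revert k; induction l as [|x l IH]; intros k.
    + simpl. rewrite Nat.add_0_r. apply H0.
    + destruct (Nat.eq_dec x 1) as [E|E].
      * rewrite count_occ_cons_eq by assumption. apply H2; [exact E|].
        rewrite Nat.add_succ_r. apply (IH (S k)).
      * rewrite count_occ_cons_neq by assumption. now apply H1.
Qed.

Definition strokes_rel (p : nat) : Prop :=
  exists l r k m, p = (l ** r) ** m /\ count_rel (l ** 0 ** k) /\ count_rel (r ** k ** m).

Lemma D_strokes_rel : definable1 strokes_rel.
Proof. unfold definable1, strokes_rel. define. Qed.
#[local] Hint Resolve D_strokes_rel : definability.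

Lemma strokes_rel_spec t m : strokes_rel (code_tape t ** m) <-> m = strokes t.
Proof.
  unfold strokes, code_tape. split.
  - intros (l & r & k & m' & E & H1 & H2). inj. apply count_rel_spec in H1, H2. subst. reflexivity.
  - intros ->. repeat eexists; apply count_rel_spec; [|reflexivity]. reflexivity.
Qed.

(** [0 ** S (1 ** 0)] and [0 ** 0] are the codes of [unary 1] and [unary 0], the two answers of a
    characteristic function. *)
Definition query_rel (A : nat -> Prop) (p : nat) : Prop :=
  exists ts ts', p = ts ** ts' /\
  ((exists io q ws m, ts = S (io ** S (q ** ws)) /\ strokes_rel (q ** m) /\
      ((A m /\ ts' = S (io ** S ((0 ** S (1 ** 0)) ** ws))) \/
       (~ A m /\ ts' = S (io ** S ((0 ** 0) ** ws))))) \/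
   (~ (exists io q ws, ts = S (io ** S (q ** ws))) /\ ts' = ts)).

Lemma D_query_rel : definable_set1 query_rel.
Proof. unfold definable_set1, query_rel. define. Qed.
#[local] Hint Resolve D_query_rel : definability.

Lemma query_rel_spec A ts u :
  query_rel A (code_tapes ts ** u) <-> u = code_tapes (query (char_fun A) ts).
Proof.
  split.
  - intros (ts0 & u' & E & H). inj. destruct H as [(io & q & ws & m & E & Hs & H)|[H ->]].
    + destruct ts as [|t0 [|t1 ts]]; simpl in E; inj. apply strokes_rel_spec in Hs. subst m.
      simpl. unfold char_fun. destruct H as [[H ->]|[H ->]];
        destruct (excluded_middle_informative _); try contradiction; reflexivity.
    + destruct ts as [|t0 [|t1 ts]]; simpl; try reflexivity. exfalso. apply H.
      repeat eexists.
  - intros ->. exists (code_tapes ts). eexists. split; [reflexivity|].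
    destruct ts as [|t0 [|t1 ts]].
    + right. split; [|reflexivity]. intros (io & q & ws & E). discriminate.
    + right. split; [|reflexivity]. intros (io & q & ws & E). simpl in E. inj.
    + left. exists (code_tape t0), (code_tape t1), (code_tapes ts), (strokes t1).
      split; [reflexivity|]. split; [now apply strokes_rel_spec|]. simpl. unfold char_fun.
      destruct (excluded_middle_informative _); [left|right]; split; auto.
Qed.

Definition step_rel (A : nat -> Prop) (p : nat) : Prop :=
  exists prog q ts c', p = prog ** (q ** ts) ** c' /\
  ((q = 1 /\ exists ts', query_rel A (ts ** ts') /\ c' = 2 ** ts') \/
   (~ q = 1 /\ find_rel ((q ** ts) ** prog ** c'))).

Lemma D_step_rel : definable_set1 step_rel.
Proof. unfold definable_set1, step_rel. define. Qed.
#[local] Hint Resolve D_step_rel : definability.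

Lemma step_rel_spec A M c d :
  step_rel A (code_list (map code_instruction (program M)) ** code_config c ** d) <->
  exists c', step (char_fun A) M c = Some c' /\ d = code_config c'.
Proof.
  destruct c as [q ts]. unfold code_config, step; simpl. unfold query_state, answer_state. split.
  - intros (prog & q' & ts' & d' & E & H). inj. destruct H as [[-> (u & Hu & ->)]|[Hq H]].
    + apply query_rel_spec in Hu. subst u. eexists. split; [reflexivity|]. reflexivity.
    + destruct (Nat.eq_dec q' 1); [contradiction|].
      apply (find_rel_spec (Config q' ts)) in H as (i & -> & ->). eexists. split; reflexivity.
  - intros (c' & E & ->). repeat eexists. destruct (Nat.eq_dec q 1) as [->|Hq].
    + left. split; [reflexivity|]. injection E as <-. eexists. split; [|reflexivity].
      now apply query_rel_spec.
    + right. split; [exact Hq|]. apply (find_rel_spec (Config q ts)).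
      destruct (find _ _) as [i|]; [|discriminate]. exists i. split; [reflexivity|].
      now injection E as <-.
Qed.

Definition reach_rel (A : nat -> Prop) (p : nat) : Prop :=
  exists prog c0 c, p = prog ** c0 ** c /\
  forall X : nat -> Prop, X c0 ->
    (forall d d', X d -> step_rel A (prog ** d ** d') -> X d') -> X c.

Lemma D_reach_rel : definable_set1 reach_rel.
Proof. unfold definable_set1, reach_rel. define. Qed.
#[local] Hint Resolve D_reach_rel : definability.

Lemma reach_rel_spec A M c d :
  reach_rel A (code_list (map code_instruction (program M)) ** code_config c ** d) <->
  exists k, d = code_config (run (char_fun A) M k c).
Proof.
  split.
  - intros (prog & c0 & d' & E & H). inj.
    apply (H (fun d => exists k, d = code_config (run (char_fun A) M k c))); clear H.
    + now exists 0.
    + intros d d1 [k ->] H. apply step_rel_spec in H as (c' & H & ->). exists (k + 1).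
      rewrite run_add. simpl. now rewrite H.
  - intros [k ->]. repeat eexists. intros X H0 H1. revert c H0.
    induction k as [|k IH]; intros c H0; simpl; [exact H0|].
    destruct (step (char_fun A) M c) as [c'|] eqn:E; [|exact H0].
    apply IH. eapply H1; [exact H0|]. apply step_rel_spec. eauto.
Qed.

Definition repeat_rel (p : nat) : Prop :=
  exists x n l, p = x ** n ** l /\
  forall X : nat -> Prop, X (0 ** 0) -> (forall n l, X (n ** l) -> X (S n ** S (x ** l))) -> X (n ** l).

Lemma D_repeat_rel : definable1 repeat_rel.
Proof. unfold definable1, repeat_rel. define. Qed.
#[local] Hint Resolve D_repeat_rel : definability.

Lemma repeat_rel_spec x n l : repeat_rel (x ** n ** l) <-> l = code_list (repeat x n).
Proof.
  split.
  - intros (x' & n' & l' & E & H). inj.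
    refine (H (fun p => forall n l, p = n ** l -> l = code_list (repeat x' n)) _ _ n' l' eq_refl); clear.
    + intros n l E. inj. reflexivity.
    + intros n l IH n' l' E. inj. simpl. now rewrite (IH n l eq_refl).
  - intros ->. repeat eexists. intros X H0 H1. induction n; simpl; auto.
Qed.

(** * Indices of machines, the jump and its iterates *)

Definition list_of (P : nat -> Prop) (l : nat) : Prop :=
  forall X : nat -> Prop, X 0 -> (forall a l, P a -> X l -> X (S (a ** l))) -> X l.

Lemma D_list_of P : definable1 P -> definable1 (list_of P).
Proof. intros HP. unfold definable1, list_of. define. Qed.
#[local] Hint Resolve D_list_of : definability.

Lemma list_of_spec {T} (code : T -> nat) P :
  (forall a, P a <-> exists x, a = code x) ->
  forall l, list_of P l <-> exists L, l = code_list (map code L).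
Proof.
  intros HP l. split.
  - intros H. apply H; clear H.
    + now exists [].
    + intros a l' Ha [L ->]. apply HP in Ha as [x ->]. now exists (x :: L).
  - intros [L ->] X H0 H1. induction L as [|x L IH]; simpl; [exact H0|].
    apply H1; [|exact IH]. apply HP. eauto.
Qed.

(** Every number is a pair and codes a list of numbers; what distinguishes the index of a machine is
    that each move is 0, 1 or 2. *)
Definition is_action (a : nat) : Prop :=
  exists x s d, a = x ** s ** d /\ (d = 0 \/ d = 1 \/ d = 2).

Definition is_instruction (i : nat) : Prop :=
  exists s l t, i = s ** l ** t /\ list_of is_action l.

Lemma D_is_action : definable1 is_action.
Proof. unfold definable1, is_action. define. Qed.
#[local] Hint Resolve D_is_action : definability.

Lemma D_is_instruction : definable1 is_instruction.
Proof. unfold definable1, is_instruction. define. Qed.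
#[local] Hint Resolve D_is_instruction : definability.

Lemma is_action_spec a : is_action a <-> exists x, a = code_action x.
Proof.
  split.
  - intros (x & s & d & -> & [-> | [-> | ->]]);
      [exists (Action x s MoveL)|exists (Action x s MoveR)|exists (Action x s Stay)]; reflexivity.
  - intros [[x s d] ->]. repeat eexists. destruct d; simpl; auto.
Qed.

Lemma is_instruction_spec i : is_instruction i <-> exists x, i = code_instruction x.
Proof.
  split.
  - intros (s & l & t & -> & H). apply (list_of_spec _ _ is_action_spec) in H as [L ->].
    now exists (Instruction s L t).
  - intros [[s l t] ->]. repeat eexists. apply (list_of_spec _ _ is_action_spec). simpl. eauto.
Qed.

(** The start is spelled out as state 0, [e] strokes on tape 0, a blank query tape and [w] blank
    work tapes. Any output counts, so a reachable configuration without successor is enough. *)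
Definition jump_rel (A : nat -> Prop) (e : nat) : Prop :=
  exists w prog l ls c, e = w ** prog /\ list_of is_instruction prog /\
    repeat_rel (1 ** e ** l) /\ repeat_rel ((0 ** 0) ** w ** ls) /\
    reach_rel A (prog ** (0 ** S ((0 ** l) ** S ((0 ** 0) ** ls))) ** c) /\
    ~ exists c', step_rel A (prog ** c ** c').

Lemma D_jump_rel : definable_set1 jump_rel.
Proof. unfold definable_set1, jump_rel. define. Qed.
#[local] Hint Resolve D_jump_rel : definability.

Lemma code_init M n : code_config (init M n) =
  0 ** S ((0 ** code_list (repeat 1 n)) ** S ((0 ** 0) ** code_list (repeat (0 ** 0) (work_tapes M)))).
Proof.
  unfold code_config, init; simpl. now rewrite map_repeat.
Qed.

Lemma jump_rel_spec A e : jump_rel A e <-> jump A e.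
Proof.
  unfold jump, computes. split.
  - intros (w & prog & l & ls & c & E & Hp & Hl & Hls & Hr & Hh).
    apply (list_of_spec _ _ is_instruction_spec) in Hp as [L ->].
    apply repeat_rel_spec in Hl, Hls. subst l ls. exists (Machine w L).
    split; [now rewrite E|].
    pose proof (code_init (Machine w L) e) as Hi. cbn [work_tapes] in Hi. rewrite <- Hi in Hr.
    apply (reach_rel_spec A (Machine w L)) in Hr as [k ->].
    eexists. exists k. split; [|reflexivity].
    destruct (step _ _ _) as [c'|] eqn:E'; [|reflexivity]. exfalso. apply Hh.
    exists (code_config c'). apply (step_rel_spec A (Machine w L)). eauto.
  - intros (M & <- & m & k & Hs & _).
    exists (work_tapes M), (code_list (map code_instruction (program M))). do 2 eexists.
    exists (code_config (run (char_fun A) M k (init M (code_machine M)))).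
    split; [reflexivity|]. split; [apply (list_of_spec _ _ is_instruction_spec); eauto|].
    split; [apply repeat_rel_spec; reflexivity|]. split; [apply repeat_rel_spec; reflexivity|].
    split.
    + rewrite <- code_init. apply reach_rel_spec. eauto.
    + intros [c' H]. apply step_rel_spec in H as (c1 & H & _). congruence.
Qed.

(** The oracle of [jump_rel] must be a set variable, so column [k] of [Z] is first given the name
    [A]. *)
Definition omega_rel (m : nat) : Prop :=
  exists Z : nat -> Prop, (forall n, ~ Z (n ** 0)) /\
  (forall k n, Z (n ** S k) <->
     exists A : nat -> Prop, (forall j, A j <-> Z (j ** k)) /\ jump_rel A n) /\
  Z m.

Lemma D_omega_rel : definable1 omega_rel.
Proof. unfold definable1, omega_rel. define. Qed.

Lemma omega_rel_spec m : omega_rel m <-> zero_omega m.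
Proof.
  split.
  - intros (Z & H0 & H1 & Hm).
    assert (E : forall k, (fun n => Z (n ** k)) = zero_jump k).
    { induction k as [|k IH]; apply functional_extensionality; intros n;
        apply propositional_extensionality.
      - split; [apply H0|contradiction].
      - change (zero_jump (S k) n) with (jump (zero_jump k) n).
        rewrite H1, <- IH, <- jump_rel_spec. split.
        + intros (A & HA & H). enough (A = fun n => Z (n ** k)) as <- by exact H.
          apply functional_extensionality. intros j. now apply propositional_extensionality.
        + intros H. eexists. split; [|exact H]. reflexivity. }
    rewrite <- (Cantor.cancel_to_of m) in Hm |- *. destruct (Cantor.of_nat m) as [n k].
    exists n, k. split; [reflexivity|]. rewrite <- E. exact Hm.
  - intros (n & k & -> & H). exists zero_omega. split; [|split].
    + intros n' (n1 & k1 & E & H'). inj. exact H'.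
    + intros k' n'. split.
      * intros (n1 & k1 & E & H'). inj. exists (zero_jump k'). split.
        -- intros j. split; [intros Hj; exists j, k'; auto|].
           intros (j1 & k1 & E & Hj). now inj.
        -- now apply jump_rel_spec.
      * intros (A & HA & Hj). exists n', (S k'). split; [reflexivity|].
        change (jump (zero_jump k') n'). enough (zero_jump k' = A) as -> by now apply jump_rel_spec.
        apply functional_extensionality. intros j. apply propositional_extensionality.
        rewrite HA. split; [intros H'; exists j, k'; auto|].
        intros (j1 & k1 & E & Hj'). now inj.
    + exists n, k. auto.
Qed.

(** * Injectivity of the coding of formulas, and the reduction *)

Lemma code_term_inj s t : code_term s = code_term t -> s = t.
Proof.
  revert t; induction s as [i|q|s1 IH1 s2 IH2|s1 IH1 s2 IH2|h s IH]; intros [j|q'|t1 t2|t1 t2|h' t] H;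
    simpl in H; apply pairn_inj in H as [H0 H]; try discriminate H0.
  - congruence.
  - apply code_Q_inj in H. congruence.
  - inj. f_equal; auto.
  - inj. f_equal; auto.
  (* Equal indices give equal machines, but a symbol also carries a proof that its machine computes
     a function; hence proof irrelevance. *)
  - inj. f_equal; [|auto]. apply code_machine_inj in H. destruct h as [M HM], h' as [M' HM'].
    simpl in H. subst M'. f_equal. apply proof_irrelevance.
Qed.

Lemma code_literal_inj l l' : code_literal l = code_literal l' -> l = l'.
Proof.
  destruct l as [[s t|s t]|[s t|s t]], l' as [[s' t'|s' t']|[s' t'|s' t']];
    simpl; intros H; apply pairn_inj in H as [H0 H]; try discriminate H0;
    apply pairn_inj in H as [H1 H]; try discriminate H1;
    apply pairn_inj in H as [H2 H]; apply code_term_inj in H2, H; congruence.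
Qed.

(** [Th_B] asks only that some true sentence has the given code; injectivity makes it the intended
    sentence. *)
Lemma code_bformula_inj phi psi : code_bformula phi = code_bformula psi -> phi = psi.
Proof.
  revert psi; induction phi as [c|q a b phi IH]; intros [c'|q' a' b' psi] H; simpl in H;
    apply pairn_inj in H as [H0 H]; try (destruct q; discriminate H0); try (destruct q'; discriminate H0).
  - f_equal. apply code_list_inj in H. apply map_inj in H; [exact H|].
    intros d d' E. apply code_list_inj in E. apply map_inj in E; [exact E|apply code_literal_inj].
  - apply pairn_inj in H as [H1 H]. apply pairn_inj in H as [H2 H].
    apply code_term_inj in H1, H2. apply IH in H. subst. f_equal.
    destruct q, q'; simpl in H0; congruence.
Qed.

Theorem theorem5p14 : many_one_reducible zero_omega Th_B.
Proof.
  destruct D_omega_rel as (phi & Hu & Hb & Hs).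
  pose (q := fun m => Qmake 1 (Pos.of_nat (S m))).
  (* A quantifier over the one-point interval at [ncode m] replaces substitution for the free
     variable, so the code of [phi] enters the reduction as a constant. *)
  pose (sentence := fun m => Quant Ex (Const (q m)) (Const (q m)) phi).
  assert (Eq : forall m, Q2R (q m) = ncode m).
  { intros m. unfold Q2R, q, ncode. cbn [Qnum Qden].
    rewrite <- (positive_nat_Z (Pos.of_nat (S m))), Nat2Pos.id, <- INR_IZR_INZ, S_INR by lia. lra. }
  exists (fun m => code_bformula (sentence m)). split.
  (* [t] computes the code of the endpoint: the tag 1 of [Const], the numerator [code_Z 1 = 1 ** 0]
     and the denominator [m + 1]. The outermost 1 is the tag of [Ex]. *)
  - pose (t := Pair (const 1) (Pair (const (1 ** 0)) (Succ (V 1)))).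
    destruct (expr_machine (Pair (const 1) (Pair t (Pair t (const (code_bformula phi)))))) as [M HM].
    exists M. intros m. specialize (HM (fun _ => 0) m).
    rewrite ev_Pair, ev_Pair, ev_Pair, !ev_const in HM.
    assert (Et : ev t [0; m] = code_term (Const (q m))).
    { unfold t. rewrite ev_Pair, ev_Pair, !ev_const. cbn [ev nth code_term].
      unfold code_Q, q. cbn [Qnum Qden]. rewrite Nat2Pos.id by lia. reflexivity. }
    rewrite Et in HM. exact HM.
  - intros m. rewrite <- omega_rel_spec.
    assert (E : sat (fun _ => 0%R) (sentence m) <-> omega_rel m).
    { cbn [sat sentence eval]. rewrite Eq. split.
      - intros (y & H1 & H2 & H). assert (y = ncode m) as -> by lra.
        apply Hs in H. simpl in H. now rewrite nval_ncode in H.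
      - intros H. exists (ncode m). split; [lra|]. split; [lra|]. apply Hs. simpl.
        now rewrite nval_ncode. }
    rewrite <- E. unfold Th_B. split.
    + intros H. exists (sentence m). split; [reflexivity|]. split; [|exact H].
      unfold is_sentence. simpl. auto.
    + intros (psi & H1 & _ & H3). apply code_bformula_inj in H1. now subst psi.
Qed.
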